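(* The language preservation problem for parametric event-recording automata is undecidable. That is, there is no algorithm that, given as input a parametric event-recording automaton $\mathsf{A}$ with parameter set $P$ and a parameter valuation $v : P \to \mathbb{Q}_{+}$, decides whether there exists a parameter valuation $v' : P \to \mathbb{Q}_{+}$ with $v' \neq v$ such that $\mathsf{UL}(v'(\mathsf{A})) = \mathsf{UL}(v(\mathsf{A}))$, where $\mathsf{UL}(v(\mathsf{A}))$ is the untimed language of $v(\mathsf{A})$, i.e. the set of all untimed words associated with maximal runs of $v(\mathsf{A})$.
   Context: $\mathbb{Q}_{+}$ and $\mathbb{R}_{+}$ denote the non-negative rationals and non-negative reals. Clocks are real-valued variables that evolve at the same rate. For a set $X$ of clocks, a clock valuation is a function $\mu : X \to \mathbb{R}_{+}$; $\vec{0}$ is the valuation assigning $0$ to all clocks; for $d \in \mathbb{R}_{+}$, $(\mu+d)(x) = \mu(x)+d$ for all $x \in X$; for $x \in X$, $[\mu]_x$ is the valuation with $[\mu]_x(x) = 0$ and $[\mu]_x(x') = \mu(x')$ for $x' \neq x$. Parameters are unknown rational constants; for a set $P$ of parameters, a parameter valuation is a function $v : P \to \mathbb{Q}_{+}$. A guard $g$ over $X \cup P$ is a conjunction of inequalities $x \bowtie \eta$ with $x \in X$, $\eta$ either a parameter in $P$ or a constant in $\mathbb{Z}$, and ${\bowtie} \in \{<,\leq,\geq,>\}$. $v(g)$ is $g$ with each parameter $p$ replaced by $v(p)$. A parametric event-recording automaton (PERA) is a tuple $\mathsf{A} = (\Sigma, L, l_0, P, I, E)$ where $\Sigma$ is a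 finite set of actions, $L$ is a finite set of locations, $l_0 \in L$ is the initial location, $P$ is a finite set of parameters, $I$ assigns to every $l \in L$ a guard $I(l)$ (the invariant), and $E$ is a finite set of edges $e = (l, g, a, l')$ with $l,l' \in L$, $a \in \Sigma$ and $g$ a guard. The clocks are $X_\Sigma = \{x_a : a \in \Sigma\}$, one clock $x_a$ per action $a$; guards are over $X_\Sigma \cup P$, and $x_a$ is implicitly reset exactly on transitions labeled with $a$. For a parameter valuation $v$, $v(\mathsf{A})$ denotes the (non-parametric) automaton obtained by replacing each parameter $p$ by $v(p)$. Semantics of $v(\mathsf{A})$: the states are $S = \{(l,\mu) \in L \times \mathbb{R}_{+}^{|X_\Sigma|} : \mu \models v(I(l))\}$, and the initial state is $s_0 = (l_0, \vec{0})$. Discrete transitions: $(l,\mu) \xrightarrow{e} (l',\mu')$ if $(l,\mu),(l',\mu') \in S$ and there is $e = (l,g,a,l') \in E$ with $\mu' = [\mu]_{x_a}$ and $\mu \models v(g)$. Delay transitions: $(l,\mu) \xrightarrow{d} (l,\mu+d)$ for $d \in \mathbb{R}_{+}$ if $(l,\mu+d') \in S$ for all $d' \in [0,d]$. A run is a finite or infinite sequence $s_0 \xrightarrow{(d_0,e_0)} s_1 \xrightarrow{(d_1,e_1)} \cdots$ starting in the initial state, where each step is a delay $d_i$ followed by a discrete transition along $e_i$. Its untimed word is $a_0 a_1 \cdots$, where $a_i$ is the action of $e_i$. A run is maximal if it is infinite or cannot be extended by a discrete transition (possibly after a delay). *)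

(* Defs.v *)
From HB Require Import structures.
From mathcomp Require Import all_boot all_order all_algebra.
From mathcomp Require Import classical_sets reals.

Set Implicit Arguments.
Unset Strict Implicit.
Unset Printing Implicit Defensive.

Import Order.TTheory GRing.Theory Num.Theory.

Local Open Scope ring_scope.

(** * Parametric event-recording automata *)

Variant cmp := CLt | CLe | CGe | CGt.

Definition cmp_code (c : cmp) : nat :=
  match c with CLt => 0 | CLe => 1 | CGe => 2 | CGt => 3 end%N.

Definition cmp_decode (n : nat) : option cmp :=
  match n with
  | 0 => Some CLt | 1 => Some CLe | 2 => Some CGe | 3 => Some CGt | _ => None
  end%N.

Lemma cmp_codeK : pcancel cmp_code cmp_decode. Proof. by case. Qed.

HB.instance Definition _ := Equality.copy cmp (pcan_type cmp_codeK).

Definition cmp_rel (R : realType) (c : cmp) (x y : R) : bool :=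
  match c with CLt => x < y | CLe => x <= y | CGe => x >= y | CGt => x > y end.

(* The clock x_a is identified with the action a.  An atom (a, c, eta) stands
   for the inequality "x_a c eta". *)
Definition atom (Sig P : finType) : Type := (Sig * cmp * (P + int))%type.

Definition guard (Sig P : finType) : Type := seq (atom Sig P).

Definition edge (Sig L P : finType) : Type := (L * guard Sig P * Sig * L)%type.

(* The finite set of edges is given by a list, used only through membership. *)
Record pera (Sig L P : finType) := Pera {
  init : L;
  inv : {ffun L -> guard Sig P};
  edges : seq (edge Sig L P)
}.

Definition Qplus : Type := {q : rat | 0 <= q}.

Definition pvaluation (P : finType) : Type := {ffun P -> Qplus}.

(** * Semantics of the automaton v(A) *)

Section Semantics.
Variables (R : realType) (Sig L P : finType).
Variables (v : pvaluation P) (A : pera Sig L P).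

Definition cvaluation : Type := {ffun Sig -> R}.

Definition zero_val : cvaluation := [ffun=> 0].

Definition shift (mu : cvaluation) (d : R) : cvaluation := [ffun x => mu x + d].

Definition reset (mu : cvaluation) (a : Sig) : cvaluation :=
  [ffun x => if x == a then 0 else mu x].

Definition bound (eta : P + int) : R :=
  match eta with inl p => ratr (val (v p)) | inr k => k%:~R end.

Definition sat_atom (mu : cvaluation) (c : atom Sig P) : bool :=
  let: (x, op, eta) := c in cmp_rel op (mu x) (bound eta).

Definition sat (mu : cvaluation) (g : guard Sig P) : bool :=
  all (sat_atom mu) g.

Definition config : Type := (L * cvaluation)%type.

Definition is_state (s : config) : Prop :=
  (forall x, 0 <= s.2 x) /\ sat s.2 (inv A s.1).

Definition init_config : config := (init A, zero_val).

Definition discrete_step (s : config) (e : edge Sig L P) (s' : config) : Prop :=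
  let: (l, g, a, l') := e in
  [/\ is_state s, is_state s', e \in edges A,
      s.1 = l /\ sat s.2 g & s' = (l', reset s.2 a)].

Definition delay_step (s : config) (d : R) (s' : config) : Prop :=
  [/\ 0 <= d, (forall d', 0 <= d' <= d -> is_state (s.1, shift s.2 d'))
    & s' = (s.1, shift s.2 d)].

Definition step (s : config) (d : R) (e : edge Sig L P) (s' : config) : Prop :=
  exists2 s1, delay_step s d s1 & discrete_step s1 e s'.

Definition edge_action (e : edge Sig L P) : Sig := e.1.2.

(* [finite_path s r s'] : the list r of triples (d_i, e_i, s_(i+1)) describes
   a finite sequence of steps from s to s'. *)
Fixpoint finite_path (s : config) (r : seq (R * edge Sig L P * config))
    (s' : config) : Prop :=
  match r with
  | [::] => s = s'
  | (d, e, s1) :: r' => step s d e s1 /\ finite_path s1 r' s'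
  end.

Definition infinite_path (s : nat -> config) (d : nat -> R)
    (e : nat -> edge Sig L P) : Prop :=
  forall i, step (s i) (d i) (e i) (s i.+1).

Definition stuck (s : config) : Prop := ~ exists d e s', step s d e s'.

End Semantics.

Variant word (Sig : Type) :=
  | FinWord of seq Sig
  | InfWord of nat -> Sig.

(* [is_state v A (init_config R A)]: the initial configuration has to be a state
   of v(A), so there is no run when it violates the initial invariant. *)
Definition UL (R : realType) (Sig L P : finType) (v : pvaluation P)
    (A : pera Sig L P) : set (word Sig) :=
  fun w => is_state v A (init_config R A) /\
    match w with
    | FinWord w =>
        exists r s, [/\ finite_path v A (init_config R A) r s,
          stuck v A s & w = [seq edge_action t.1.2 | t <- r]]
    | InfWord w =>
        exists s d e, [/\ s 0%N = init_config R A,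
          infinite_path v A s d e & forall i, w i = edge_action (e i)]
    end.

(* An input of the decision problem.  Up to renaming, the finite sets of
   actions, locations and parameters are initial segments of nat. *)
Record instance := Instance {
  nact : nat;
  nloc : nat;
  npar : nat;
  aut : pera 'I_nact 'I_nloc 'I_npar;
  par : pvaluation 'I_npar
}.

Definition language_preservation (R : realType) (I : instance) : Prop :=
  exists v' : pvaluation 'I_(npar I),
    v' <> par I /\ UL R v' (aut I) = UL R (par I) (aut I).

(** * Encoding of the inputs as natural numbers *)

Definition ser_seq (T : Type) (f : T -> seq nat) (s : seq T) : seq nat :=
  size s :: flatten (map f s).

Definition ser_int (k : int) : seq nat :=
  match k with Posz n => [:: 0; n] | Negz n => [:: 1; n] end%N.

Definition ser_rat (q : rat) : seq nat := ser_int (numq q) ++ ser_int (denq q).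

Definition ser_atom (m p : nat) (c : atom 'I_m 'I_p) : seq nat :=
  let: (x, op, eta) := c in
  [:: nat_of_ord x; cmp_code op] ++
  match eta with
  | inl i => [:: 0%N; nat_of_ord i]
  | inr k => 1%N :: ser_int k
  end.

Definition ser_edge (m l p : nat) (e : edge 'I_m 'I_l 'I_p) : seq nat :=
  let: (l1, g, a, l2) := e in
  [:: nat_of_ord l1; nat_of_ord a; nat_of_ord l2] ++ ser_seq (@ser_atom m p) g.

Definition ser_instance (I : instance) : seq nat :=
  [:: nact I; nloc I; npar I; nat_of_ord (init (aut I))]
  ++ ser_seq (fun q : Qplus => ser_rat (val q)) (codom (par I))
  ++ ser_seq (ser_seq (@ser_atom _ _)) (codom (inv (aut I)))
  ++ ser_seq (@ser_edge _ _ _) (edges (aut I)).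

(* [CodeSeq.code] is the computable bijection from seq nat to nat with
   code [::] = 0 and code (n :: s) = 2 ^ n * (2 * code s + 1). *)
Definition encode (I : instance) : nat := CodeSeq.code (ser_instance I).

Definition prefix_inj (T : Type) (f : T -> seq nat) :=
  forall x y s t, f x ++ s = f y ++ t -> x = y /\ s = t.

Lemma ser_seq_inj (T : Type) (f : T -> seq nat) :
  prefix_inj f -> prefix_inj (ser_seq f).
Proof.
move=> fI x y s t [].
elim: x y => [|a x IH] [|b y] //= [] sz; rewrite -!catA => /fI[-> {}/IH].
by case=> // -> ->.
Qed.

Lemma ser_int_inj : prefix_inj ser_int.
Proof. by case=> n [] m s t //= [-> ->]. Qed.

Lemma ser_rat_inj : prefix_inj ser_rat.
Proof.
move=> x y s t; rewrite /ser_rat -!catA => /ser_int_inj[nE /ser_int_inj[dE ->]].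
by split=> //; rewrite -(divq_num_den x) nE dE divq_num_den.
Qed.

Lemma ser_Qplus_inj : prefix_inj (fun q : Qplus => ser_rat (val q)).
Proof. by move=> x y s t /ser_rat_inj[/val_inj-> ->]. Qed.

Lemma ser_atom_inj m p : prefix_inj (@ser_atom m p).
Proof.
move=> [[x op] e] [[x' op'] e'] s t /= [/val_inj-> /(pcan_inj cmp_codeK)->].
case: e e' => [i|k] [i'|k'] //= []; first by move=> /val_inj-> ->.
by move=> /ser_int_inj[-> ->].
Qed.

Lemma ser_edge_inj m l p : prefix_inj (@ser_edge m l p).
Proof.
move=> [[[l1 g] a] l2] [[[l1' g'] a'] l2'] s t.
rewrite /= => -[/val_inj-> /val_inj-> /val_inj-> sz gs].
have gI := ser_seq_inj (@ser_atom_inj m p).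
by have [|-> ->] // := gI g g' s t; rewrite /= sz gs.
Qed.

Lemma codom_ffun_inj (n : nat) (T : Type) (f g : {ffun 'I_n -> T}) :
  codom f = codom g -> f = g.
Proof. by move=> fg; apply/ffunP => i; have /eq_in_map := fg; apply; exact: mem_enum. Qed.

Lemma encode_inj : injective encode.
Proof.
move=> I J /(can_inj CodeSeq.codeK).
case: I J => [a l p [i inv_ E] v] [a' l' p' [i' inv' E'] v'].
move=> eqIJ; case: (eqIJ) => ? ? ? _ _ _; subst a' l' p'.
have /val_inj -> := congr1 (nth 0%N ^~ 3) eqIJ : val i = val i'.
have [/codom_ffun_inj-> H] :=
  ser_seq_inj ser_Qplus_inj (congr1 (drop 4) eqIJ
    : ser_seq _ (codom v) ++ _ = ser_seq _ (codom v') ++ _).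
have [/codom_ffun_inj/= -> {}H] :=
  ser_seq_inj (ser_seq_inj (@ser_atom_inj _ _)) H.
suff [-> _] : E = E' /\ [::] = [::] :> seq nat by [].
by apply: (ser_seq_inj (@ser_edge_inj _ _ _)); rewrite !cats0.
Qed.

(** * Algorithms: Minsky register machines *)

(* Every natural number names a register.  [Dec r k] decrements register r and
   moves on to the next instruction if r is nonzero, and jumps to instruction k
   if r is zero.  A machine halts when the program counter leaves the program. *)
Variant instr := Inc of nat | Dec of nat & nat.

Definition machine : Type := seq instr.

Definition mconfig : Type := (nat * (nat -> nat))%type.

Definition set_reg (rho : nat -> nat) (r x : nat) : nat -> nat :=
  fun r' => if r' == r then x else rho r'.

Definition mstep (M : machine) (c : mconfig) : mconfig :=
  let: (pc, rho) := c in
  match onth M pc with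
  | None => c
  | Some (Inc r) => (pc.+1, set_reg rho r (rho r).+1)
  | Some (Dec r k) =>
      if rho r is x.+1 then (pc.+1, set_reg rho r x) else (k, rho)
  end.

(* The input is given in register 0, all other registers being 0, and the
   output is read in register 0 when the machine halts. *)
Definition minit (n : nat) : mconfig := (0%N, set_reg (fun=> 0%N) 0%N n).

Definition computes (M : machine) (n out : nat) : Prop :=
  exists k, let c := iter k (mstep M) (minit n) in
    (size M <= c.1)%N /\ c.2 0%N = out.

Definition decides (T : Type) (code : T -> nat) (M : machine) (Q : T -> Prop) :
    Prop :=
  forall x, (Q x -> computes M (code x) 1%N) /\ (~ Q x -> computes M (code x) 0%N).

Definition decidable_problem (T : Type) (code : T -> nat) (Q : T -> Prop) :
    Prop :=
  exists M, decides code M Q.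

(* Main.v *)
Require Import Defs.
From mathcomp Require Import all_boot all_order all_algebra.
From mathcomp Require Import boolp classical_sets reals.
From mathcomp Require Import lra zify.

(** The proof is a diagonal argument on top of a simulation of register machines
by automata with one parameter p, whose reference value is 0.  Register r is
stored as the distance modulo p between two marker clocks, each of which is
reset whenever it reaches p.  To increment (decrement) r, one marker is reset
one time unit too late, which moves it against the other by 1; r is zero when
the two markers reach p together.  An increment that reaches p makes one marker
meet the other during that time unit, and then the letter [bad] can be emitted.
An unconstrained part of the automaton produces all nonempty words without
[bad].  For p = 0 the simulation cannot start.  Hence the language is preserved
by some p > 0 iff the registers stay bounded during the simulated run.

The input k of the simulated machine D occurs in the encoded automaton only as
an integer constant, so its code is obtained by filling k into a template that
depends on D alone.  Take for k a number that encodes this template.  If M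
decided the problem, D could compute from k the code of its own automaton, run
M on it, and let a register grow for ever iff M answers that the language is
preserved: a contradiction. *)

Set Implicit Arguments.
Unset Strict Implicit.
Unset Printing Implicit Defensive.

Import Order.TTheory GRing.Theory Num.Theory.

Local Arguments mstep : simpl never.

(** * Structured register machine programs *)

Definition instr_reg (i : instr) : nat :=
  match i with Inc r => r | Dec r _ => r end.

Lemma mstep_nth D pc rho : pc < size D -> mstep D (pc, rho) =
  match nth (Inc 0) D pc with
  | Inc r => (pc.+1, set_reg rho r (rho r).+1)
  | Dec r j => if rho r is x.+1 then (pc.+1, set_reg rho r x) else (j, rho)
  end.
Proof. by move=> lt; rewrite /mstep onthE (nth_map (Inc 0)) //; case: nth. Qed.

Notation regs := (nat -> nat).

(** [PRaw] embeds a machine with arbitrary jumps, so that a hypothetical decision machine can serve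
    as a subroutine. *)
Inductive prog :=
  | PInc of nat
  | PSeq of prog & prog
  | PLoop of nat & prog
  | PIf of nat & prog & prog
  | PRaw of machine.

(* [PLoop r p] and [PIf r p q] decrement r before entering p. *)
Inductive exec : prog -> regs -> regs -> Prop :=
  | ExecInc r rho : exec (PInc r) rho (set_reg rho r (rho r).+1)
  | ExecSeq p q rho rho1 rho2 :
      exec p rho rho1 -> exec q rho1 rho2 -> exec (PSeq p q) rho rho2
  | ExecLoop0 r p rho : rho r = 0 -> exec (PLoop r p) rho rho
  | ExecLoopS r p rho x rho1 rho2 : rho r = x.+1 ->
      exec p (set_reg rho r x) rho1 -> exec (PLoop r p) rho1 rho2 ->
      exec (PLoop r p) rho rho2
  | ExecIf0 r p q rho rho1 : rho r = 0 -> exec q rho rho1 -> exec (PIf r p q) rho rho1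
  | ExecIfS r p q rho x rho1 : rho r = x.+1 -> exec p (set_reg rho r x) rho1 ->
      exec (PIf r p q) rho rho1
  | ExecRaw M n pc rho rho1 : iter n (mstep M) (0, rho) = (pc, rho1) ->
      size M <= pc -> exec (PRaw M) rho rho1.

Fixpoint psize (p : prog) : nat :=
  match p with
  | PInc _ => 1
  | PSeq p q => psize p + psize q
  | PLoop _ p => (psize p).+2
  | PIf _ p q => (psize p + psize q).+2
  | PRaw M => size M
  end.

(** Jump targets beyond the end are cut down to [len]: wherever the embedded machine halts, control
    passes to the instruction just after its block. *)
Definition relocate (off len : nat) (i : instr) : instr :=
  match i with Inc r => Inc r | Dec r j => Dec r (off + minn j len) end.

(* Register z stays 0, so [Dec z j] is an unconditional jump. *)
Fixpoint compile (z off : nat) (p : prog) : machine :=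
  match p with
  | PInc r => [:: Inc r]
  | PSeq p q => compile z off p ++ compile z (off + psize p) q
  | PLoop r p => Dec r (off + psize p).+2 :: compile z off.+1 p ++ [:: Dec z off]
  | PIf r p q => Dec r (off + psize p).+2 :: compile z off.+1 p ++
      Dec z (off + psize p + psize q).+2 :: compile z (off + psize p).+2 q
  | PRaw M => map (relocate off (size M)) M
  end.

Fixpoint avoids (z : nat) (p : prog) : bool :=
  match p with
  | PInc r => r != z
  | PSeq p q => avoids z p && avoids z q
  | PLoop r p => (r != z) && avoids z p
  | PIf r p q => [&& r != z, avoids z p & avoids z q]
  | PRaw M => all (fun i => instr_reg i != z) M
  end.

Lemma size_compile z off p : size (compile z off p) = psize p.
Proof.
elim: p off => //= [p IHp q IHq|r p IH|r p IHp q IHq|M] off.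
- by rewrite size_cat IHp IHq.
- by rewrite size_cat IH addn1.
- by rewrite size_cat /= IHp IHq addnS.
- by rewrite size_map.
Qed.

Lemma set_reg_ne rho r x s : s != r -> set_reg rho r x s = rho s.
Proof. by rewrite /set_reg => /negPf ->. Qed.

Lemma set_reg_eq rho r x : set_reg rho r x r = x.
Proof. by rewrite /set_reg eqxx. Qed.

Lemma mstep_Inc D pc rho r : onth D pc = Some (Inc r) ->
  mstep D (pc, rho) = (pc.+1, set_reg rho r (rho r).+1).
Proof. by rewrite /mstep => ->. Qed.

Lemma mstep_Dec0 D pc rho r j : onth D pc = Some (Dec r j) -> rho r = 0 ->
  mstep D (pc, rho) = (j, rho).
Proof. by rewrite /mstep => -> ->. Qed.

Lemma mstep_DecS D pc rho r j x : onth D pc = Some (Dec r j) -> rho r = x.+1 ->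
  mstep D (pc, rho) = (pc.+1, set_reg rho r x).
Proof. by rewrite /mstep => -> ->. Qed.

Lemma mstep_halt D pc rho : size D <= pc -> mstep D (pc, rho) = (pc, rho).
Proof. by move=> h; rewrite /mstep onth_default. Qed.

Lemma mstep_avoid M z c : all (fun i => instr_reg i != z) M -> (mstep M c).2 z = c.2 z.
Proof.
case: c => pc rho av; have [lt|ge] := ltnP pc (size M); last by rewrite mstep_halt.
have := all_nthP (Inc 0) av pc lt.
rewrite mstep_nth //; case: nth => [r|r j] /= rz; first by rewrite set_reg_ne // eq_sym.
by case: (rho r) => //= x; rewrite set_reg_ne // eq_sym.
Qed.

Lemma exec_avoid p rho rho1 z : exec p rho rho1 -> avoids z p -> rho1 z = rho z.
Proof.
elim=> {p rho rho1} /= [r rho rz|p q rho rho1 rho2 _ IHp _ IHq /andP[/IHp <- /IHq <-]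
  |//|r p rho x rho1 rho2 _ _ IHp _ IHl /andP[rz av]|r p q rho rho1 _ _ IH /and3P[_ _ /IH]
  |r p q rho x rho1 _ _ IH /and3P[rz /IH -> _]|M n pc rho rho1 nE _ av] //.
- by rewrite set_reg_ne // eq_sym.
- by rewrite IHl ?rz // IHp // set_reg_ne // eq_sym.
- by rewrite set_reg_ne // eq_sym.
- rewrite -[rho1]/((pc, rho1).2) -nE; elim: n {nE} => //= n IH.
  by rewrite mstep_avoid.
Qed.

(** * Correctness of compiled code inside a larger machine *)

Definition runs (D : machine) (c c' : mconfig) : Prop :=
  exists n, iter n (mstep D) c = c'.

Lemma runs_refl D c : runs D c c.
Proof. by exists 0. Qed.

Lemma runs_trans D c1 c2 c3 : runs D c1 c2 -> runs D c2 c3 -> runs D c1 c3.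
Proof. by move=> [n <-] [m <-]; exists (m + n); rewrite iterD. Qed.

Lemma runs_step D c1 c2 c3 : mstep D c1 = c2 -> runs D c2 c3 -> runs D c1 c3.
Proof. by move=> s; apply: runs_trans; exists 1. Qed.

Definition code_at (D : machine) (off : nat) (s : machine) : Prop :=
  forall i, i < size s -> onth D (off + i) = onth s i.

Lemma code_at_cat D off s t :
  code_at D off (s ++ t) -> code_at D off s /\ code_at D (off + size s) t.
Proof.
move=> c; split=> i hi.
  by rewrite c ?onth_cat ?hi // size_cat ltn_addr.
by rewrite -addnA c ?size_cat ?ltn_add2l // onth_cat ltnNge leq_addr /= addKn.
Qed.

Lemma code_at_cons D off i s :
  code_at D off (i :: s) -> onth D off = Some i /\ code_at D off.+1 s.
Proof.
move=> /(@code_at_cat _ _ [:: i] s) [c1 c2]; rewrite addn1 in c2; split=> //.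
by have := c1 0 isT; rewrite addn0.
Qed.

(** [minn] identifies all halted positions of [M]. Once [M] has halted, its further steps are idle
    and the host machine makes none. *)
Lemma runs_relocate D M off n pc rho pc' rho' :
  code_at D off (map (relocate off (size M)) M) ->
  iter n (mstep M) (pc, rho) = (pc', rho') ->
  runs D (off + minn pc (size M), rho) (off + minn pc' (size M), rho').
Proof.
move=> cM; elim: n pc rho => [|n IH] pc rho; first by case=> -> ->; apply: runs_refl.
rewrite iterSr; have [lt|ge] := ltnP pc (size M); last first.
  by rewrite mstep_halt // => /IH; rewrite (minn_idPr ge).
have oM : onth D (off + pc) = Some (relocate off (size M) (nth (Inc 0) M pc)).
  by rewrite cM ?size_map // onthE -map_comp (nth_map (Inc 0)).
rewrite mstep_nth //; case: nth oM => [r|r j] /= oM.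
  by move=> /IH; rewrite (minn_idPl lt) addnS; apply: runs_step; apply: mstep_Inc.
case rE: (rho r) => [|x] /IH; apply: runs_step; first exact: mstep_Dec0 oM rE.
by rewrite (minn_idPl lt) addnS; apply: mstep_DecS oM rE.
Qed.

(** Induction on the execution, not on the program, since a loop runs the same code repeatedly.
    Register [z] stays 0 by [exec_avoid], so every jump through it is taken. *)
Lemma compile_correct p rho rho1 z D off : exec p rho rho1 -> avoids z p -> rho z = 0 ->
  code_at D off (compile z off p) -> runs D (off, rho) (off + psize p, rho1).
Proof.
move=> ex; elim: ex off => {p rho rho1} /=
  [r rho|p q rho rho1 rho2 exp IHp exq IHq|r p rho r0
  |r p rho x rho1 rho2 rS exp IHp exl IHl|r p q rho rho1 r0 exq IHq
  |r p q rho x rho1 rS exp IHp|M n pc rho rho1 nE le_pc] off.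
- move=> _ _ /code_at_cons[o _]; apply: runs_step (mstep_Inc _ o) _.
  by rewrite addn1; apply: runs_refl.
- move=> /andP[ap aq] z0 /code_at_cat[cp]; rewrite size_compile => cq.
  apply: runs_trans (IHp _ ap z0 cp) _; rewrite addnA; apply: IHq => //.
  by rewrite (exec_avoid exp ap).
- move=> _ _ /code_at_cons[o _]; apply: runs_step (mstep_Dec0 o r0) _.
  by rewrite !addnS; apply: runs_refl.
- move=> /andP[rz ap] z0 c; have /code_at_cons[o /code_at_cat[cp]] := c.
  rewrite size_compile => /code_at_cons[oz _].
  have z0' : set_reg rho r x z = 0 by rewrite set_reg_ne // eq_sym.
  have z1 : rho1 z = 0 by rewrite (exec_avoid exp ap).
  apply: runs_step (mstep_DecS o rS) _; apply: runs_trans (IHp _ ap z0' cp) _.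
  apply: runs_step (mstep_Dec0 oz z1) _; apply: IHl => //; exact/andP.
- move=> /and3P[rz ap aq] z0 /code_at_cons[o /code_at_cat[_]].
  rewrite size_compile => /code_at_cons[_]; rewrite addSn => cq.
  apply: runs_step (mstep_Dec0 o r0) _.
  by have := IHq _ aq z0 cq; rewrite !addSn !addnS addnA.
- move=> /and3P[rz ap aq] z0 /code_at_cons[o /code_at_cat[cp]].
  rewrite size_compile => /code_at_cons[oz _].
  have z0' : set_reg rho r x z = 0 by rewrite set_reg_ne // eq_sym.
  have z1 : rho1 z = 0 by rewrite (exec_avoid exp ap).
  apply: runs_step (mstep_DecS o rS) _; apply: runs_trans (IHp _ ap z0' cp) _.
  apply: runs_step (mstep_Dec0 oz z1) _.
  by rewrite !addnS addnA; apply: runs_refl.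
- move=> _ _ cM; have := runs_relocate cM nE.
  by rewrite min0n addn0 (minn_idPr le_pc).
Qed.

(** * Programs that fill the input into a template *)

Definition st (l : seq nat) : regs := nth 0 l.

Lemma set_st l r x : set_reg (st l) r x = st (set_nth 0 l r x).
Proof. by apply/funext => s; rewrite /st nth_set_nth /set_reg. Qed.

Lemma exec_eq p rho rho1 rho2 : exec p rho rho1 -> rho1 = rho2 -> exec p rho rho2.
Proof. by move=> h <-. Qed.

Lemma exec_inc r l : exec (PInc r) (st l) (st (set_nth 0 l r (nth 0 l r).+1)).
Proof. by apply: exec_eq (ExecInc r (st l)) _; rewrite set_st. Qed.

(** Here [s i] is the state at the head of the loop when [i] rounds remain. *)
Lemma exec_loop r p (s : nat -> regs) n : (forall i, i <= n -> s i r = i) ->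
  (forall i, i < n -> exec p (set_reg (s i.+1) r i) (s i)) ->
  exec (PLoop r p) (s n) (s 0).
Proof.
elim: n => [|n IH] sr sp; first exact/ExecLoop0/sr.
apply: ExecLoopS (sr _ (leqnn _)) (sp _ (leqnn _)) _.
by apply: IH => i lt; [apply: sr; rewrite ltnW|apply: sp; apply: leq_trans lt _].
Qed.

Lemma exec_loop_st r p (l : nat -> seq nat) n : (forall i, i <= n -> nth 0 (l i) r = i) ->
  (forall i, i < n -> exec p (st (set_nth 0 (l i.+1) r i)) (st (l i))) ->
  exec (PLoop r p) (st (l n)) (st (l 0)).
Proof.
move=> lr lp; apply: (exec_loop (s := fun i => st (l i))) => // i lt.
by rewrite set_st; apply: lp.
Qed.

(* Registers: 0 input template, 1 its copy k, 2 quotient, 3 result, 4 scratch,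
   5 and 6 remainder flags, 7 scratch copy of k. *)
Definition Double : prog :=
  PSeq (PLoop 3 (PSeq (PInc 4) (PInc 4))) (PLoop 4 (PInc 3)).

Definition Shift : prog := PSeq (PLoop 1 (PSeq (PInc 7) Double)) (PLoop 7 (PInc 1)).

(** Units are removed in threes. A remainder of 1 or 2 sets flag 5 or 6; remainder 0 leaves both
    flags clear. *)
Definition Divide : prog :=
  PLoop 0 (PIf 0 (PIf 0 (PInc 2) (PInc 6)) (PInc 5)).

(** The enclosing loop has already removed the unit that [numeral] adds to each digit. Testing a
    flag with [PIf] also clears it. The quotient finally returns to register 0. *)
Definition Digit : prog :=
  PSeq Divide (PSeq (PIf 5 Double (PIf 6 (PSeq Double (PInc 3)) Shift)) (PLoop 2 (PInc 0))).

(** Register 0 is copied because the same number plays two parts: it is consumed as the template and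
    inserted as k. *)
Definition Instantiate : prog :=
  PSeq (PLoop 0 (PSeq (PInc 1) (PInc 2))) (PSeq (PLoop 2 (PInc 0))
    (PSeq (PLoop 0 Digit) (PSeq (PLoop 1 (PRaw [::])) (PLoop 3 (PInc 0))))).

Lemma exec_double t k q x f1 f2 j :
  exec Double (st [:: t; k; q; x; 0; f1; f2; j]) (st [:: t; k; q; x.*2; 0; f1; f2; j]).
Proof.
apply: ExecSeq.
  have := @exec_loop_st 3 (PSeq (PInc 4) (PInc 4))
    (fun i => [:: t; k; q; i; (x - i).*2; f1; f2; j]) x.
  rewrite subnn subn0; apply=> // i lt /=.
  apply: ExecSeq (exec_inc _ _) (exec_eq (exec_inc _ _) _) => /=.
  by do 2 f_equal; congr [:: _, _, _, _, _ & _]; lia.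
have := @exec_loop_st 4 (PInc 3) (fun i => [:: t; k; q; x.*2 - i; i; f1; f2; j]) x.*2.
rewrite subnn subn0; apply=> // i lt /=.
by apply: exec_eq (exec_inc _ _) _ => /=; congr (st [:: _, _, _, _ & _]); lia.
Qed.

Lemma exec_shift t k q x :
  exec Shift (st [:: t; k; q; x; 0; 0; 0; 0]) (st [:: t; k; q; 2 ^ k * x; 0; 0; 0; 0]).
Proof.
apply: ExecSeq.
  have := @exec_loop_st 1 (PSeq (PInc 7) Double)
    (fun i => [:: t; i; q; 2 ^ (k - i) * x; 0; 0; 0; k - i]) k.
  rewrite subnn subn0 expn0 mul1n; apply=> // i lt /=.
  apply: ExecSeq (exec_inc _ _) _; apply: exec_eq (exec_double _ _ _ _ _ _ _) _ => /=.
  by rewrite (subnSK lt) -(subnSK lt) expnS -mulnA mul2n.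
have := @exec_loop_st 7 (PInc 1)
  (fun i => [:: t; k - i; q; 2 ^ k * x; 0; 0; 0; i]) k.
rewrite subnn subn0; apply=> // i lt /=.
by apply: exec_eq (exec_inc _ _) _ => /=; congr (st [:: _, _ & _]); lia.
Qed.

(* [None] stands for multiplication by 2 ^ k, [Some b] for appending the bit b. *)
Definition digit : Type := option bool.

Definition digit_val (d : digit) : nat :=
  match d with None => 0 | Some false => 1 | Some true => 2 end.

Definition apply_digit (k x : nat) (d : digit) : nat :=
  match d with None => 2 ^ k * x | Some b => b + x.*2 end.

(* Bijective base 3, least significant digit first: digit d counts digit_val d + 1,
   so that the end of the sequence is recognised by the value 0. *)
Definition numeral (ds : seq digit) : nat :=
  foldr (fun d n => (digit_val d + 3 * n).+1) 0 ds.

Lemma exec_loopS r p l x rho1 rho2 : nth 0 l r = x.+1 ->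
  exec p (st (set_nth 0 l r x)) rho1 -> exec (PLoop r p) rho1 rho2 ->
  exec (PLoop r p) (st l) rho2.
Proof. by rewrite -set_st; apply: ExecLoopS. Qed.

Lemma exec_ifS r p q l x rho1 : nth 0 l r = x.+1 ->
  exec p (st (set_nth 0 l r x)) rho1 -> exec (PIf r p q) (st l) rho1.
Proof. by rewrite -set_st; apply: ExecIfS. Qed.

Lemma exec_divide d q n k x :
  exec Divide (st [:: digit_val d + 3 * q; k; n; x; 0; 0; 0; 0])
    (st [:: 0; k; n + q; x; 0; nat_of_bool (d == Some false);
            nat_of_bool (d == Some true); 0]).
Proof.
rewrite /Divide; elim: q n => [|q IH] n; last first.
  have -> : digit_val d + 3 * q.+1 = (digit_val d + 3 * q).+3 by lia.
  rewrite -[n + _]addSnnS; eapply exec_loopS; [reflexivity | | exact: IH]; rewrite /=.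
  eapply exec_ifS; first reflexivity; rewrite /=.
  eapply exec_ifS; first reflexivity; rewrite /=.
  exact: exec_inc.
rewrite muln0 !addn0; case: d => [[]|] /=.
- eapply exec_loopS; [reflexivity | | exact: ExecLoop0]; rewrite /=.
  eapply exec_ifS; first reflexivity; rewrite /=; apply: ExecIf0 => //; exact: exec_inc.
- eapply exec_loopS; [reflexivity | | exact: ExecLoop0]; rewrite /=.
  apply: ExecIf0 => //; exact: exec_inc.
- exact: ExecLoop0.
Qed.

Lemma exec_digits ds k x :
  exec (PLoop 0 Digit) (st [:: numeral ds; k; 0; x; 0; 0; 0; 0])
    (st [:: 0; k; 0; foldl (apply_digit k) x ds; 0; 0; 0; 0]).
Proof.
elim: ds x => [|d ds IH] x /=; first exact: ExecLoop0.
eapply exec_loopS; [reflexivity | | exact: IH]; rewrite /=.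
apply: ExecSeq (exec_divide _ _ _ _ _) _; rewrite add0n.
apply: (ExecSeq (rho1 := st [:: 0; k; numeral ds; apply_digit k x d; 0; 0; 0; 0])).
  case: d => [[]|] /=.
  - apply: ExecIf0 => //; eapply exec_ifS; first reflexivity; rewrite /=.
    exact: ExecSeq (exec_double _ _ _ _ _ _ _) (exec_inc _ _).
  - eapply exec_ifS; first reflexivity; rewrite /=; exact: exec_double.
  - by apply: ExecIf0 => //; apply: ExecIf0 => //; exact: exec_shift.
have := @exec_loop_st 2 (PInc 0)
  (fun i => [:: numeral ds - i; k; i; apply_digit k x d; 0; 0; 0; 0]) (numeral ds).
rewrite subnn subn0; apply=> // i lt /=.
by apply: exec_eq (exec_inc _ _) _ => /=; congr (st [:: _ & _]); lia.
Qed.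

(** All registers but 0 end at 0, so another machine can start from the result as from an initial
    configuration. *)
Lemma exec_instantiate ds :
  exec Instantiate (set_reg (fun=> 0) 0 (numeral ds))
    (set_reg (fun=> 0) 0 (foldl (apply_digit (numeral ds)) 0 ds)).
Proof.
have pad x : set_reg (fun=> 0) 0 x = st [:: x; 0; 0; 0; 0; 0; 0; 0].
  by apply/funext; do 9 case=> //.
rewrite !pad; move: (numeral ds) (exec_digits ds (numeral ds) 0) => k exD.
set y := foldl _ _ _ in exD *.
apply: (ExecSeq (rho1 := st [:: 0; k; k; 0; 0; 0; 0; 0])).
  have := @exec_loop_st 0 (PSeq (PInc 1) (PInc 2))
    (fun i => [:: i; k - i; k - i; 0; 0; 0; 0; 0]) k.
  rewrite subnn subn0; apply=> // i lt /=.
  apply: ExecSeq (exec_inc _ _) (exec_eq (exec_inc _ _) _) => /=.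
  by congr (st [:: _, _, _ & _]); lia.
apply: (ExecSeq (rho1 := st [:: k; k; 0; 0; 0; 0; 0; 0])).
  have := @exec_loop_st 2 (PInc 0)
    (fun i => [:: k - i; k; i; 0; 0; 0; 0; 0]) k.
  rewrite subnn subn0; apply=> // i lt /=.
  by apply: exec_eq (exec_inc _ _) _ => /=; congr (st [:: _ & _]); lia.
apply: ExecSeq exD _; apply: (ExecSeq (rho1 := st [:: 0; 0; 0; y; 0; 0; 0; 0])).
  apply: (@exec_loop_st 1 (PRaw [::]) (fun i => [:: 0; i; 0; y; 0; 0; 0; 0]) k)
    => // i lt /=.
  exact: (ExecRaw (n := 0) (erefl _)).
have := @exec_loop_st 3 (PInc 0) (fun i => [:: y - i; 0; 0; i; 0; 0; 0; 0]) y.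
rewrite subnn subn0; apply=> // i lt /=.
by apply: exec_eq (exec_inc _ _) _ => /=; congr (st [:: _ & _]); lia.
Qed.

(** A [None] in the template is a hole for k. As [code (n :: s)] is 2 ^ n * (2 * code s + 1), the
    digits of the tail come first, then a bit 1, then n bits 0, or one multiplication by 2 ^ k at a
    hole. *)
Fixpoint digits (T : seq (option nat)) : seq digit :=
  if T is o :: T' then
    digits T' ++ Some true :: (if o is Some n then nseq n (Some false) else [:: None])
  else [::].

Lemma digitsP k T :
  foldl (apply_digit k) 0 (digits T) = CodeSeq.code (map (odflt k) T).
Proof.
elim: T => //= o T IH; rewrite foldl_cat IH /=.
set x := CodeSeq.code _; rewrite add1n; case: o => [n|] //=.
have -> : foldl (apply_digit k) x.*2.+1 (nseq n (Some false)) = 2 ^ n * x.*2.+1.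
  elim: n x.*2.+1 => [|n IHn] y /=; first by rewrite mul1n.
  by rewrite IHn add0n -mul2n mulnA -expnSr.
by [].
Qed.

(** * The diagonal machine *)

(** Halts at once if register 0 is 0. Otherwise each round adds one unit on balance, and the loop
    never ends. *)
Definition Grow : prog := PLoop 0 (PSeq (PInc 0) (PInc 0)).

Definition diagonal_prog (M : machine) : prog :=
  PSeq (PSeq Instantiate (PRaw M)) Grow.

(** Lies above every register of [M] and above 7, the last register of [Instantiate]. *)
Definition zero_reg (M : machine) : nat := (\max_(r <- map instr_reg M) r + 7).+1.

Definition diagonal (M : machine) : machine := compile (zero_reg M) 0 (diagonal_prog M).

Lemma diagonal_avoids M : avoids (zero_reg M) (diagonal_prog M).
Proof.
rewrite /= /zero_reg; set m := \max_(_ <- _) _.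
have le_m : all (fun i => instr_reg i <= m) M.
  rewrite /m; elim: M {m} => //= i M IH; rewrite big_cons leq_maxl /=.
  by apply: sub_all IH => j /leq_trans; apply; apply: leq_maxr.
have ne r : r <= m + 7 -> r != (m + 7).+1 by lia.
rewrite !ne ?leq_addl ?(leq_trans _ (leq_addl _ _)) //= !andbT.
by apply: sub_all le_m => i /= le; apply/ne/(leq_trans le)/leq_addr.
Qed.

Section Diagonal.
Variables (M : machine) (ds : seq digit) (out : nat).
Let k := numeral ds.
Let D := diagonal M.
Let z := zero_reg M.

Hypothesis Mout : computes M (foldl (apply_digit k) 0 ds) out.

Let off := psize (PSeq Instantiate (PRaw M)).

Lemma diagonal_out : exists rho, [/\ runs D (minit k) (off, rho), rho z = 0,
  rho 0 = out & code_at D off (compile z off Grow)].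
Proof.
have [n [le_M outE]] := Mout.
have := diagonal_avoids M; rewrite {1}/diagonal_prog [avoids _ (PSeq _ _)]/=.
move=> /andP[av _].
have cD : code_at D 0 (compile z 0 (diagonal_prog M)) by [].
have [cP] := @code_at_cat D 0 (compile z 0 (PSeq Instantiate (PRaw M)))
  (compile z (psize (PSeq Instantiate (PRaw M))) Grow) cD.
rewrite size_compile add0n => cG.
move: le_M outE; case nE: (iter n _ _) => [pc rho] /= le_M outE.
have ex : exec (PSeq Instantiate (PRaw M)) (minit k).2 rho.
  exact: ExecSeq (exec_instantiate ds) (ExecRaw nE le_M).
exists rho; split=> //.
  exact: compile_correct ex av erefl cP.
by rewrite (exec_avoid ex av).
Qed.

Lemma diagonal_halts : out = 0 ->
  exists n, size D <= (iter n (mstep D) (minit k)).1.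
Proof.
move=> out0; have [rho [rk z0 rho0 cG]] := diagonal_out.
have av : avoids z Grow by have /andP[] := diagonal_avoids M.
rewrite out0 in rho0; have ex : exec Grow rho rho by apply: ExecLoop0.
have [n nE] := runs_trans rk (compile_correct ex av z0 cG).
by exists n; rewrite nE size_compile.
Qed.

Lemma diagonal_grows B : out = 1 -> exists n, B <= (iter n (mstep D) (minit k)).2 0.
Proof.
move=> out1; have [rho [rk z0 rho0 cG]] := diagonal_out.
have [o0 /code_at_cons[o1 /code_at_cons[o2 /code_at_cons[o3 _]]]] := code_at_cons cG.
(* [exec] describes terminating executions only, so the endless loop is followed instruction by
   instruction; at its head register 0 takes every positive value. *)
suff [rho' [n nE] [_ rhoB]] : exists2 rho', runs D (minit k) (off, rho') &
    rho' z = 0 /\ rho' 0 = B.+1.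
  by exists n; rewrite nE /= rhoB.
elim: B => [|B [rho' rk' [z0' rhoB]]]; first by exists rho; rewrite ?rho0.
eexists.
  apply: runs_trans rk' (runs_step (mstep_DecS o0 rhoB) _).
  apply: runs_step (mstep_Inc _ o1) (runs_step (mstep_Inc _ o2) _).
  by apply: runs_step (mstep_Dec0 o3 _) (runs_refl _ _); rewrite !set_reg_ne.
by split; [rewrite !set_reg_ne | rewrite !set_reg_eq].
Qed.

End Diagonal.

(** * Growth of the registers along a run *)

Lemma mstep_le D c B r : (forall s, c.2 s <= B) -> (mstep D c).2 r <= B.+1.
Proof.
case: c => pc rho /= leB; rewrite /mstep; case: onth => [[s|s j]|] /=; last exact: leqW.
  by rewrite /set_reg; case: ifP => _; [rewrite ltnS | apply: leqW].
case E: (rho s) => [|x] /=; first exact: leqW.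
rewrite /set_reg; case: ifP => _; last exact: leqW.
by have := leB s; rewrite E => h; apply/leqW/ltnW.
Qed.

Lemma iter_mstep_le D k n r : (iter n (mstep D) (minit k)).2 r <= k + n.
Proof.
elim: n r => [|n IH] r /=; first by rewrite /set_reg addn0; case: ifP.
by rewrite addnS; apply: mstep_le.
Qed.

Lemma halted_le D k n m r : size D <= (iter n (mstep D) (minit k)).1 ->
  (iter m (mstep D) (minit k)).2 r <= k + n.
Proof.
move=> halt; have [le|/ltnW le] := leqP m n.
  by apply: leq_trans (iter_mstep_le _ _ _ _) _; rewrite leq_add2l.
rewrite -(subnK le) iterD; set c := iter n _ _ in halt *.
suff -> : iter (m - n) (mstep D) c = c by apply: iter_mstep_le.
elim: (m - n) => //= i ->; by case: c halt => pc rho; exact: mstep_halt.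
Qed.

Local Open Scope ring_scope.

(** * The simulating automaton *)

Section Automaton.
Variable D : machine.

Definition instr_at (pc : 'I_(size D)) : instr := nth (Inc 0) D pc.

Definition max_reg : nat := \max_(pc < size D) instr_reg (instr_at pc).

(* (r, false) and (r, true) are the two markers of register r; its value is
   the reset time of the first minus that of the second, modulo p. *)
Definition marker : finType := ('I_(max_reg).+1 * bool)%type.
Definition act : finType := (marker + bool)%type.
Definition loc : finType := (option bool + 'I_(size D) * bool)%type.

Definition mk (r : nat) (b : bool) : act := inl (inord r, b).
Definition tick : act := inr false.
Definition bad : act := inr true.

Definition start : loc := inl None.
Definition free : loc := inl (Some true).
Definition dead : loc := inl (Some false).
Definition run_at (pc : 'I_(size D)) : loc := inr (pc, false).
(* In [wait_at pc] one marker is moved: [tick] was reset when that marker reached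
   p, and the marker is reset when [tick] reaches 1. *)
Definition wait_at (pc : 'I_(size D)) : loc := inr (pc, true).
(** A program counter outside the program means that the machine has halted, which becomes the
    deadlock [dead]. *)
Definition enter (pc : nat) : loc :=
  if insub pc is Some i then run_at i else dead.

Definition par0 : 'I_1 + int := inl ord0.

(** Delaying the reset of the first marker raises the difference of the reset times; delaying the
    second lowers it. *)
Definition moved (i : instr) : act :=
  match i with Inc r => mk r false | Dec r _ => mk r true end.

(* The clocks that are reset whenever they reach p. *)
Definition rotating (l : loc) : pred act := fun a =>
  match l, a with
  | inr (pc, w), inl _ => ~~ w || (a != moved (instr_at pc))
  | _, _ => false
  end.

(** Together with the lower bounds in the guards, these upper bounds force a rotating clock to be
    reset exactly at p, and the moved marker exactly when [tick] is 1. *)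
Definition loc_inv (l : loc) : guard act 'I_1 :=
  [seq (a, CLe, par0) | a <- enum act & rotating l a] ++
  (if l is inr (_, true) then [:: (tick, CLe, inr 1)] else [::]).

(* The second edge for [Dec] is the zero test in the case where, of two coinciding
   markers, the first one has already been reset. *)
Definition out_edges (l : loc) : seq (guard act 'I_1 * act * loc) :=
  [seq ([:: (a, CGe, par0)], a, l) | a <- enum act & rotating l a] ++
  match l with
  | inl (Some false) => [::]
  | inl _ => [seq ([::], a, if b then free else dead)
                 | a <- [seq a <- enum act | a != bad], b <- [:: true; false]]
  | inr (pc, false) =>
      match instr_at pc with
      | Inc r => [:: ([:: (mk r false, CGe, par0)], tick, wait_at pc)]
      | Dec r j =>
          [:: ([:: (mk r true, CGe, par0); (mk r false, CGe, par0)],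
               tick, enter j);
              ([:: (mk r true, CGe, par0); (mk r false, CLe, inr 0)],
               tick, enter j);
              ([:: (mk r true, CGe, par0); (mk r false, CGt, inr 0);
                   (mk r false, CLt, par0)], tick, wait_at pc)]
      end
  | inr (pc, true) =>
      ([:: (tick, CGe, inr 1)], moved (instr_at pc), enter pc.+1) ::
      (if instr_at pc is Inc r then
         [:: ([:: (mk r true, CGe, par0); (tick, CGt, inr 0)], bad, dead)]
       else [::])
  end.

(* The first edge stores k in register 0; it needs k < p.  The second one emits
   [bad] when 0 < p <= k. *)
Definition start_edges (k : nat) : seq (guard act 'I_1 * act * loc) :=
  [:: ([:: (tick, CGe, inr (Posz k)); (tick, CLe, inr (Posz k));
           (tick, CLt, par0)], mk 0 false, enter 0);
      ([:: (tick, CGt, inr 0); (tick, CGe, par0); (tick, CLe, par0);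
           (tick, CLe, inr (Posz k))], bad, dead)].

Definition all_edges (k : nat) (l : loc) : seq (guard act 'I_1 * act * loc) :=
  (if l is inl None then start_edges k else [::]) ++ out_edges l.

(** Problem instances have ordinals as actions and locations, so the automaton is transported along
    [enum_rank]. *)
Definition ren_guard (g : guard act 'I_1) : guard 'I_#|act| 'I_1 :=
  [seq (enum_rank c.1.1, c.1.2, c.2) | c <- g].

Definition ren_edge (l : loc) (t : guard act 'I_1 * act * loc) :
    edge 'I_#|act| 'I_#|loc| 'I_1 :=
  (enum_rank l, ren_guard t.1.1, enum_rank t.1.2, enum_rank t.2).

(** The edges that contain k are listed first, which puts k at explicit positions of the
    serialization. *)
Definition simulator (k : nat) : pera 'I_#|act| 'I_#|loc| 'I_1 :=
  Pera (enum_rank start) [ffun l => ren_guard (loc_inv (enum_val l))]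
    (map (ren_edge start) (start_edges k) ++
     flatten [seq map (ren_edge l) (out_edges l) | l <- enum loc]).

Lemma ren_edge_in k l t : t \in all_edges k l -> ren_edge l t \in edges (simulator k).
Proof.
rewrite {1}mem_cat => tl; rewrite /edges /simulator mem_cat; apply/orP.
case/orP: tl => tl; last first.
  by right; apply/flatten_mapP; exists l; [exact: mem_enum | exact: map_f].
by case: l tl => [[b|]|q] // tl; left; exact: map_f.
Qed.

Lemma edges_inv k e : e \in edges (simulator k) ->
  exists l t, t \in all_edges k l /\ e = ren_edge l t.
Proof.
rewrite /edges /simulator mem_cat => /orP[/mapP[t tl ->]|/flatten_mapP[l _ /mapP[t tl ->]]].
  by exists start, t; rewrite mem_cat tl.
by exists l, t; rewrite mem_cat tl orbT.
Qed.

Lemma out_edges_inv l g a l' : (g, a, l') \in out_edges l ->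
  [\/ [/\ rotating l a, g = [:: (a, CGe, par0)] & l' = l],
      [/\ (exists b, l = inl b), g = [::], a <> bad & l' = free \/ l' = dead],
      exists2 pc, l = run_at pc &
        a = tick /\
        match instr_at pc with
        | Inc r => g = [:: (mk r false, CGe, par0)] /\ l' = wait_at pc
        | Dec r j =>
            [\/ g = [:: (mk r true, CGe, par0); (mk r false, CGe, par0)] /\
                l' = enter j,
                g = [:: (mk r true, CGe, par0); (mk r false, CLe, inr 0)] /\
                l' = enter j |
                g = [:: (mk r true, CGe, par0); (mk r false, CGt, inr 0);
                        (mk r false, CLt, par0)] /\ l' = wait_at pc]
        end |
      exists2 pc, l = wait_at pc &
        [/\ g = [:: (tick, CGe, inr 1)], a = moved (instr_at pc) &
            l' = enter pc.+1] \/
        if instr_at pc is Inc r then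
          [/\ g = [:: (mk r true, CGe, par0); (tick, CGt, inr 0)], a = bad &
            l' = dead]
        else False].
Proof.
rewrite mem_cat => /orP[/mapP[b]|].
  by rewrite mem_filter => /andP[rb _] [-> -> ->]; constructor 1.
case: l => [b|[pc []]].
- case: b => [[|]|] // /allpairsP[[c b]] /=;
  rewrite mem_filter => -[/andP[/eqP cbad _] _ [-> -> ->]]; constructor 2;
  by (split=> //; [eexists | case: b; [left|right]]).
- rewrite in_cons => /orP[/eqP[-> -> ->]|]; first by constructor 4; exists pc; [|left].
  case E: (instr_at pc) => [r|//]; rewrite inE => /eqP[-> -> ->].
  by constructor 4; exists pc => //; right; rewrite E.
- case E: (instr_at pc) => [r|r j]; rewrite ?inE.
    by move=> /eqP[-> -> ->]; constructor 3; exists pc; rewrite ?E.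
  by move=> /or3P[] /eqP[-> -> ->]; constructor 3; exists pc => //; rewrite E;
    split=> //; [constructor 1|constructor 2|constructor 3].
Qed.

(** * Steps of the simulator in terms of its clocks *)

Section Valuation.
Variables (R : realType) (v : pvaluation 'I_1) (k : nat).

Let A := simulator k.
Let p : R := ratr (val (v ord0)).

Implicit Types (mu nu : cvaluation R 'I_#|act|) (l : loc) (a : act).

Definition at_loc l mu : config R 'I_#|act| 'I_#|loc| := (enum_rank l, mu).

Definition clk mu a : R := mu (enum_rank a).

Definition nonneg mu := forall a, 0 <= clk mu a.

Definition sat0 (f : act -> R) (g : guard act 'I_1) : bool :=
  all (fun c => cmp_rel c.1.2 (f c.1.1) (bound R v c.2)) g.

Lemma sat_ren mu g : sat v mu (ren_guard g) = sat0 (clk mu) g.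
Proof. by rewrite /sat all_map; apply: eq_all => -[[]]. Qed.

Lemma sat0_cons (f : act -> R) c (g : guard act 'I_1) :
  sat0 f (c :: g) = cmp_rel c.1.2 (f c.1.1) (bound R v c.2) && sat0 f g.
Proof. by []. Qed.

Lemma clk_shift mu d a : clk (shift mu d) a = clk mu a + d.
Proof. by rewrite /clk ffunE. Qed.

Lemma clk_reset mu b a : clk (reset mu (enum_rank b)) a = if a == b then 0 else clk mu a.
Proof. by rewrite /clk ffunE (inj_eq enum_rank_inj). Qed.

Lemma nonneg_shift mu d : nonneg mu -> 0 <= d -> nonneg (shift mu d).
Proof. by move=> h d0 a; rewrite clk_shift addr_ge0. Qed.

Lemma nonneg_reset mu b : nonneg mu -> nonneg (reset mu (enum_rank b)).
Proof. by move=> h a; rewrite clk_reset; case: ifP. Qed.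

Lemma is_stateE l mu :
  is_state v A (at_loc l mu) <-> nonneg mu /\ sat0 (clk mu) (loc_inv l).
Proof.
rewrite /is_state /= ffunE enum_rankK sat_ren; split=> -[h ?]; split=> //.
- by move=> a; apply: h.
- by move=> x; rewrite -(enum_valK x); apply: h.
Qed.

Lemma sat_invariantP (f : act -> R) l :
  reflect ((forall a, rotating l a -> f a <= p) /\
           (if l is inr (_, true) then f tick <= 1 else True))
    (sat0 f (loc_inv l)).
Proof.
rewrite /sat0 all_cat all_map; apply: (iffP andP) => -[h1 h2]; split.
- by move=> a ra; move/allP: h1 => /(_ a); rewrite mem_filter ra mem_enum; apply.
- by case: l h1 h2 => [//|[pc []] //] _ /=; rewrite andbT.
- by apply/allP => a; rewrite mem_filter => /andP[ra _]; apply: h1.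
- by case: l h1 h2 => [//|[pc []] //] _ /=; rewrite andbT.
Qed.

(** Invariants only bound clocks from above, so the one of [l] need only be checked at the end of
    the delay. *)
Lemma step_intro l mu d g a l' :
  (g, a, l') \in all_edges k l -> 0 <= d -> nonneg mu ->
  sat0 (clk (shift mu d)) (loc_inv l) -> sat0 (clk (shift mu d)) g ->
  sat0 (clk (reset (shift mu d) (enum_rank a))) (loc_inv l') ->
  step v A (at_loc l mu) d (ren_edge l (g, a, l'))
    (at_loc l' (reset (shift mu d) (enum_rank a))).
Proof.
move=> e_in d0 mu0 invl satg invl'.
have st d' : 0 <= d' <= d -> is_state v A (at_loc l (shift mu d')).
  move=> /andP[d'0 d'd]; apply/is_stateE; split; first exact: nonneg_shift.
  move/sat_invariantP: invl => [h1 h2]; apply/sat_invariantP; split.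
    move=> b /h1; apply: le_trans; rewrite !clk_shift; lra.
  case: l h2 {h1 e_in} => // -[pc []] //; apply: le_trans; rewrite !clk_shift; lra.
exists (at_loc l (shift mu d)); first by split.
split=> //.
- by apply: st; rewrite d0 lexx.
- by apply/is_stateE; split=> //; apply/nonneg_reset/nonneg_shift.
- exact: ren_edge_in.
- by split=> //=; rewrite sat_ren.
Qed.

Lemma step_elim l mu d e s' : step v A (at_loc l mu) d e s' ->
  exists g a l',
  [/\ (g, a, l') \in all_edges k l, edge_action e = enum_rank a,
      s' = at_loc l' (reset (shift mu d) (enum_rank a)),
      [/\ 0 <= d, nonneg mu & nonneg (shift mu d)] &
      [/\ sat0 (clk (shift mu d)) (loc_inv l), sat0 (clk (shift mu d)) g &
          sat0 (clk (reset (shift mu d) (enum_rank a))) (loc_inv l')]].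
Proof.
case=> s1 [d0 st ->] {s1}; case: e => [[[l1 g1] a1] l1'] [] _ st' /edges_inv.
move=> [l0 [[[g a] l'] [e_in [-> -> -> ->]]]] [/enum_rank_inj /= le sg] s'E.
subst l0 s'; have := st 0; rewrite lexx d0 => /(_ isT)/is_stateE[mu0 _].
have := st d; rewrite lexx d0 => /(_ isT)/is_stateE[mud invl].
move/is_stateE: st' => [_ invl']; rewrite sat_ren in sg.
exists g, a, l'; split=> //; split=> //.
by move=> b; have := mu0 b; rewrite clk_shift addr0.
Qed.

(** * Register values as clock differences modulo p *)

Lemma mkE (m : marker) : inl m = mk m.1 m.2.
Proof. by rewrite /mk inord_val -surjective_pairing. Qed.

Lemma mk_eq r s b c : (r <= max_reg)%N -> (s <= max_reg)%N ->
  (mk r b == mk s c) = (r == s) && (b == c).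
Proof.
move=> hr hs; rewrite /mk (inj_eq (@inl_inj _ _)) xpair_eqE.
by congr (_ && _); rewrite -val_eqE /= !inordK.
Qed.

(* Equals the value of register r modulo p, see [good]. *)
Definition gap (f : act -> R) r : R := f (mk r true) - f (mk r false).

(** Both clocks lie in [0, p], so the gap lies in [-p, p] and the three cases exhaust the residue
    class of [rho r]. The third arises only for value 0, with the first marker just reset and the
    second at p. *)
Definition good (f : act -> R) (rho : nat -> nat) : Prop :=
  forall r, (r <= max_reg)%N ->
    [/\ 0 <= f (mk r false) <= p, 0 <= f (mk r true) <= p, (rho r)%:R < p &
        [\/ gap f r = (rho r)%:R, gap f r = (rho r)%:R - p |
            gap f r = (rho r)%:R + p]].

(** A common delay keeps the gap and a rotation changes it by p; the bounds on the clocks exclude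
    all values outside the list. *)
Lemma good_mod (f g : act -> R) d rho : good f rho ->
  (forall r b, (r <= max_reg)%N ->
    0 <= g (mk r b) <= p /\
    (g (mk r b) = f (mk r b) + d \/ g (mk r b) = f (mk r b) + d - p)) ->
  good g rho.
Proof.
move=> gf H r hr; have [f1 f2 lt_p gapf] := gf r hr.
have [g1 g1E] := H r false hr; have [g2 g2E] := H r true hr.
split=> //; have ge0 : 0 <= (rho r)%:R :> R by rewrite ler0n.
rewrite /gap in gapf *.
case: gapf => gapf; case: g1E => g1E; case: g2E => g2E;
  ((constructor 1; lra) || (constructor 2; lra) || (constructor 3; lra) || lra).
Qed.

(* The marker being moved counts as if it had been reset together with [tick]. *)
Definition virt l (f : act -> R) : act -> R := fun a =>
  match l with
  | inr (pc, true) => if a == moved (instr_at pc) then f tick else f a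
  | _ => f a
  end.

Lemma virt_rot l f a : rotating l a -> virt l f a = f a.
Proof. by case: l => [|[pc []]] // ; case: a => //= m /negPf ->. Qed.

Lemma virtP pc w f r b :
  rotating (inr (pc, w)) (mk r b) /\ virt (inr (pc, w)) f (mk r b) = f (mk r b) \/
  [/\ w, ~~ rotating (inr (pc, w)) (mk r b), mk r b = moved (instr_at pc) &
      virt (inr (pc, w)) f (mk r b) = f tick].
Proof.
case: w => /=; last by left.
by case: eqVneq => [->|]; [right|left].
Qed.

(** Even while waiting, [rho] is the register content before the instruction at [pc]; hence the
    positivity for a pending decrement. *)
Definition simulates (pc : 'I_(size D)) (w : bool) (f : act -> R) rho : Prop :=
  good (virt (inr (pc, w)) f) rho /\
  (w -> f tick <= 1 /\ if instr_at pc is Dec r _ then (0 < rho r)%N else True).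

Lemma instr_reg_le pc : (instr_reg (instr_at pc) <= max_reg)%N.
Proof. exact: (leq_bigmax (F := fun i => instr_reg (instr_at i))). Qed.

Lemma mstepE (pc : 'I_(size D)) rho : mstep D (val pc, rho) =
  match instr_at pc with
  | Inc r => (pc.+1, set_reg rho r (rho r).+1)
  | Dec r j => if rho r is x.+1 then (pc.+1, set_reg rho r x) else (j, rho)
  end.
Proof. exact: mstep_nth (ltn_ord pc). Qed.

(** The first marker drops from 1 to 0 against an unchanged second one, so the gap grows by 1. *)
Lemma good_inc (f g : act -> R) rho r : (r <= max_reg)%N -> good f rho ->
  f (mk r false) = 1 -> (rho r)%:R + 1 < p ->
  (forall a, g a = if a == mk r false then 0 else f a) ->
  good g (set_reg rho r (rho r).+1).
Proof.
move=> hr gf f1 lt_p gE s hs; have [x1 x2 ltp gapf] := gf s hs.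
rewrite /gap !gE !mk_eq // !andbF andbT /set_reg; move: gapf x1 x2 ltp; rewrite /gap.
case: eqVneq => [->|_] gapf x1 x2 ltp; last by split.
have rho0 : 0 <= (rho r)%:R :> R by rewrite ler0n.
rewrite -natr1; split=> //; first lra.
by case: gapf => h; [constructor 1|constructor 2|constructor 3]; lra.
Qed.

Lemma good_dec (f g : act -> R) rho r x : (r <= max_reg)%N -> good f rho ->
  f (mk r true) = 1 -> rho r = x.+1 ->
  (forall a, g a = if a == mk r true then 0 else f a) ->
  good g (set_reg rho r x).
Proof.
move=> hr gf f1 rhoE gE s hs; have [x1 x2 ltp gapf] := gf s hs.
rewrite /gap !gE !mk_eq // !andbF andbT /set_reg; move: gapf x1 x2 ltp; rewrite /gap.
case: eqVneq => [->|_] gapf x1 x2 ltp; last by split.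
have x0 : 0 <= x%:R :> R by rewrite ler0n.
rewrite rhoE -natr1 in gapf ltp; split=> //; try lra.
by case: gapf => h; [constructor 1|constructor 2|constructor 3]; lra.
Qed.

(** * The language of the nonempty words without [bad] *)

Definition bad_free (w : word 'I_#|act|) : Prop :=
  match w with
  | FinWord w => w <> [::] /\ enum_rank bad \notin w
  | InfWord w => forall i, w i <> enum_rank bad
  end.

Lemma init_state : is_state v A (init_config R A).
Proof.
apply/(is_stateE start); split=> [a|]; first by rewrite /clk ffunE.
by apply/sat_invariantP.
Qed.

Lemma step_free b l mu (a : 'I_#|act|) (c : bool) : l = inl b -> b != Some false ->
  nonneg mu -> a <> enum_rank bad ->
  exists2 e, edge_action e = a &
    step v A (at_loc l mu) 0 e
      (at_loc (if c then free else dead) (reset (shift mu 0) a)).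
Proof.
move=> -> bn mu0 an; rewrite -(enum_valK a) in an *; set x := enum_val a in an *.
have xn : x != bad by apply: contra_notN an => /eqP ->.
exists (ren_edge (inl b) ([::], x, if c then free else dead)) => //.
have inv0 o f : sat0 f (loc_inv (inl o)).
  by apply/sat_invariantP.
apply: step_intro => //; try exact: inv0; last by case: c; exact: inv0.
rewrite !mem_cat; apply/orP; right; apply/orP; right.
case: b bn => [[]|] // _; apply/allpairsP; exists (x, c);
  by split; [rewrite mem_filter xn mem_enum | case: (c) | ].
Qed.

Lemma dead_stuck mu : stuck v A (at_loc dead mu).
Proof.
move=> [d [e [s' /step_elim[g [a [l' [e_in _ _ _ _]]]]]]].
by move: e_in; rewrite mem_cat /= mem_cat orbF => /mapP[b]; rewrite mem_filter.
Qed.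

Lemma free_path b l mu w (a : 'I_#|act|) : l = inl b -> b != Some false -> nonneg mu ->
  enum_rank bad \notin rcons w a ->
  exists r nu, finite_path v A (at_loc l mu) r (at_loc dead nu) /\
    [seq edge_action t.1.2 | t <- r] = rcons w a.
Proof.
elim: w b l mu => [|c w IH] b l mu lE bn mu0 /=.
  rewrite inE => /eqP/nesym nb; have [e eE st] := step_free false lE bn mu0 nb.
  by exists [:: (0, e, at_loc dead (reset (shift mu 0) a))]; eexists; rewrite /= eE.
rewrite inE negb_or => /andP[/eqP/nesym nb wb].
have [e eE st] := step_free true lE bn mu0 nb.
have [|r [nu [pr rE]]] := IH _ _ (reset (shift mu 0) c) (erefl free) isT _ wb.
  by rewrite -(enum_valK c); apply/nonneg_reset/nonneg_shift.
exists ((0, e, at_loc free (reset (shift mu 0) c)) :: r), nu.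
by rewrite /= eE rE.
Qed.

(** The unconstrained part produces all these words with zero delays, a finite one entering [dead]
    on its last letter. Conversely, the inductive invariant [safe] excludes [bad], and the empty run
    is not maximal because [start] always offers a step. *)
Lemma UL_bad_free (safe : config R 'I_#|act| 'I_#|loc| -> Prop) :
  safe (init_config R A) ->
  (forall s d e s', safe s -> step v A s d e s' ->
     safe s' /\ edge_action e <> enum_rank bad) ->
  UL R v A = bad_free.
Proof.
move=> safe0 safeS.
have zero0 : nonneg (zero_val R 'I_#|act|) by move=> a; rewrite /clk ffunE.
apply/seteqP; split=> -[w|w] /=.
- move=> [_ [r [s [pr st wE]]]]; split.
    move=> w0; move: wE; rewrite w0; case: r pr => // s0 _; apply: st.
    rewrite -s0; have [|e _ stp] := @step_free None start (zero_val R 'I_#|act|)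
      (enum_rank tick) true erefl isT zero0.
      by move/enum_rank_inj.
    by exists 0, e; eexists; exact: stp.
  rewrite {}wE; elim: r (init_config R A) safe0 pr {st} => [|[[d e] s1] r IH] s0 ok //=.
  move=> [st pr]; have [ok1 eb] := safeS _ _ _ _ ok st.
  by rewrite inE negb_or (IH s1) // andbT; apply/eqP/nesym.
- move=> [_ [s [d [e [s0 pr wE]]]]] i; rewrite wE.
  have ok : safe (s i) by elim: i => [|i IH]; [rewrite s0 | have [] := safeS _ _ _ _ IH (pr i)].
  by have [] := safeS _ _ _ _ ok (pr i).
- move=> [w0 wb]; split; first exact: init_state.
  case/lastP: w w0 wb => // w a _ wb.
  have [r [nu [pr rE]]] := free_path (erefl start) isT zero0 wb.
  by exists r, (at_loc dead nu); split=> //; exact: dead_stuck.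
- move=> wb; split; first exact: init_state.
  pose mu := fix mu i := if i is j.+1 then reset (shift (mu j) 0) (w j)
                         else zero_val R 'I_#|act|.
  have mu0 i : nonneg (mu i).
    elim: i => //= i IH; rewrite -(enum_valK (w i)).
    by apply/nonneg_reset/nonneg_shift.
  pose s i := at_loc (if i is 0 then start else free) (mu i).
  have st i : exists e, edge_action e = w i /\ step v A (s i) 0 e (s i.+1).
    have [e eE st] : exists2 e, edge_action e = w i & step v A (s i) 0 e (s i.+1).
      by case: i => [|i]; apply: (step_free true).
    by exists e.
  have [e eP] := choice st.
  by exists s, (fun=> 0), e; split=> // i; have [] := eP i.
Qed.

Lemma start_edges_inv g a l' : (g, a, l') \in start_edges k ->
  [/\ g = [:: (tick, CGe, inr (Posz k)); (tick, CLe, inr (Posz k));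
              (tick, CLt, par0)], a = mk 0 false & l' = enter 0] \/
  [/\ g = [:: (tick, CGt, inr 0); (tick, CGe, par0); (tick, CLe, par0);
              (tick, CLe, inr (Posz k))], a = bad & l' = dead].
Proof. by rewrite !inE => /orP[] /eqP[-> -> ->]; [left|right]. Qed.

(** For p = 0 both edges of [start_edges] are disabled: one asks for [tick] < 0, the other for 0 <
    [tick] <= 0. *)
Lemma UL_zero : p = 0 -> UL R v A = bad_free.
Proof.
move=> p0; apply: (UL_bad_free (safe := fun s => s = at_loc start (zero_val R _) \/
  exists b mu, s = at_loc (inl (Some b)) mu)); first by left.
move=> s d e s' safe_s st.
have [b [mu [sE bmu]]] : exists b mu, s = at_loc (inl b) mu /\ (b = None -> mu = zero_val R _).
  by case: safe_s => [->|[b [mu ->]]]; [exists None | exists (Some b)]; eexists.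
rewrite sE in st; have [g [a [l' [e_in eE -> [d0 _ mu0] [_ sg _]]]]] := step_elim st.
rewrite eE; move: e_in; rewrite mem_cat => /orP[|e_in].
  case: b bmu {st sE} => // _ /start_edges_inv[] [gE _ _]; exfalso; move: sg (mu0 tick);
    rewrite gE !sat0_cons /= -/p p0 => /and4P[]; lra.
case: (out_edges_inv e_in) => [[]|[_ _ an l'E]|[pc]|[pc]] //.
split; last by move/enum_rank_inj.
by right; case: l'E => ->; eexists; eexists.
Qed.

(** * Soundness: runs of the automaton follow the machine *)

Hypothesis p_ge1 : 1 <= p.

(** Serves for delays and, with d = 0, for rotations. While waiting, the moved marker is represented
    by [tick], which is at most 1 and hence at most p. *)
Lemma simulates_shift pc w f g d rho : simulates pc w f rho -> 0 <= d ->
  (forall a, 0 <= g a) -> sat0 g (loc_inv (inr (pc, w))) ->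
  (forall a, ~~ rotating (inr (pc, w)) a -> g a = f a + d) ->
  (forall a, rotating (inr (pc, w)) a -> g a = f a + d \/ g a = f a + d - p) ->
  simulates pc w g rho.
Proof.
move=> [gf fw] d0 g0 /sat_invariantP[g1 g2] gE gR; split; last first.
  by case: w gf fw g1 g2 gE gR => // gf /(_ isT)[_ fD] *; split.
apply: (good_mod gf (d := d)) => r b hr.
have [[rot ->]|[wT nrot mkE' ->]] := virtP pc w g r b.
  by rewrite virt_rot // g0 g1 //; split=> //; apply: gR.
case: w wT gf fw g1 g2 gE gR nrot => // _ _ _ _ g2 gE _ nrot.
by rewrite /= mkE' eqxx g0 /=; split; [exact: le_trans p_ge1 | left; exact: gE].
Qed.
Lemma good_eq (f g : act -> R) rho :
  good f rho -> (forall r b, g (mk r b) = f (mk r b)) -> good g rho.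
Proof.
move=> gf gE; apply: (good_mod gf (d := 0)) => r b hr.
by have [f1 f2 _ _] := gf r hr; rewrite gE addr0; case: b; split=> //; left.
Qed.

Lemma good_zero (f : act -> R) rho r : (r <= max_reg)%N -> good f rho ->
  p <= f (mk r true) -> p <= f (mk r false) \/ f (mk r false) <= 0 -> rho r = 0%N.
Proof.
move=> hr gf xp yp; have [f1 f2 ltp gapf] := gf r hr; rewrite /gap in gapf.
case: (rho r) ltp gapf => // n; rewrite -natr1 => ltp gapf.
have n0 : 0 <= n%:R :> R by rewrite ler0n.
by exfalso; case: gapf => ?; case: yp => ?; lra.
Qed.

Lemma good_pos (f : act -> R) rho r : (r <= max_reg)%N -> good f rho ->
  p <= f (mk r true) -> 0 < f (mk r false) < p -> (0 < rho r)%N.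
Proof.
move=> hr gf xp yp; have [f1 f2 ltp gapf] := gf r hr; rewrite /gap in gapf.
by rewrite lt0n; apply/eqP => h; rewrite h in gapf ltp; case: gapf => ?; lra.
Qed.

(** The moved marker is at p, and [tick], just reset, now stands for it: replacing p by 0 keeps the
    gap modulo p. *)
Lemma simulates_wait pc (g h : act -> R) rho :
  good g rho -> p <= g (moved (instr_at pc)) ->
  (if instr_at pc is Dec r _ then (0 < rho r)%N else True) ->
  (forall b, h b = if b == tick then 0 else g b) ->
  simulates pc true h rho.
Proof.
move=> gg gp rpos hE; split; last by move=> _; rewrite hE eqxx; split.
apply: (good_mod gg (d := 0)) => r b hr; have [g1 g2 _ _] := gg r hr.
have gb : 0 <= g (mk r b) <= p by case: (b).
have [[rot ->]|[_ _ mE ->]] := virtP pc true h r b.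
  by rewrite hE /= addr0; split=> //; left.
rewrite hE eqxx lexx (le_trans _ p_ge1) //; split=> //; right.
by rewrite mE in gb *; rewrite /=; lra.
Qed.

(** The moved marker counts as 1 before its reset and is 0 after it; this shift of the gap by 1
    carries out the instruction. *)
Lemma simulates_exit pc (g h : act -> R) rho :
  simulates pc true g rho -> g tick = 1 ->
  (if instr_at pc is Inc r then (rho r)%:R + 1 < p else true) ->
  (forall b, h b = if b == moved (instr_at pc) then 0 else g b) ->
  exists2 rho', mstep D (val pc, rho) = (pc.+1, rho') & good h rho'.
Proof.
move=> [gg /(_ isT)[_ gD]] gt1 bnd hE; have mE := mstepE pc rho.
have hr := instr_reg_le pc.
have hE' b : h b = if b == moved (instr_at pc) then 0 else virt (inr (pc, true)) g b.
  by rewrite hE /=; case: ifP.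
have vm : virt (inr (pc, true)) g (moved (instr_at pc)) = 1 by rewrite /= eqxx.
case E: (instr_at pc) mE hr bnd gD hE' vm => [r|r j] mE /= hr bnd gD hE' vm.
  exists (set_reg rho r (rho r).+1) => //.
  exact: (good_inc hr gg vm bnd hE').
case rE: (rho r) mE gD => [//|x] mE _; have gd := good_dec hr gg vm rE.
by exists (set_reg rho r x) => //; exact: gd.
Qed.

Lemma simulates_le pc w f rho a : simulates pc w f rho ->
  rotating (inr (pc, w)) a -> f a <= p.
Proof.
case: a => [m|[]] [gf _] //.
have hm : (m.1 <= max_reg)%N by rewrite -ltnS.
rewrite mkE => rot; rewrite -(virt_rot f rot).
by have [f1 f2 _ _] := gf _ hm; case: (m.2); [case/andP: f2|case/andP: f1].
Qed.

Lemma simulates_invariant pc w f rho : simulates pc w f rho ->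
  sat0 f (loc_inv (inr (pc, w))).
Proof.
move=> sf; apply/sat_invariantP; split=> [a|]; first exact: simulates_le sf.
by case: w sf => // -[_ /(_ isT)[]].
Qed.

(** A rotation or the start of a wait keeps the simulated configuration; a zero test or the end of a
    wait performs one machine step. *)
Lemma simulates_step pc w (f g h : act -> R) d rho l a guard l' :
  simulates pc w f rho -> 0 <= d ->
  (guard, a, l') \in out_edges l -> l = inr (pc, w) ->
  (forall b, 0 <= g b) -> sat0 g (loc_inv l) -> sat0 g guard ->
  (forall b, g b = f b + d) ->
  (forall b, h b = if b == a then 0 else g b) ->
  (forall r, (r <= max_reg)%N -> (rho r)%:R + 1 < p) ->
  a != bad /\
  [\/ exists w', l' = inr (pc, w') /\ simulates pc w' h rho |
      exists pc' rho',
        [/\ l' = enter pc', mstep D (val pc, rho) = (pc', rho') & good h rho']].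
Proof.
move=> sf d0 e_in lE g0 gi sg gE hE bnd.
have {sf} gs : simulates pc w g rho.
  by apply: (simulates_shift sf d0) => // [|b _]; [rewrite -lE|left].
case: (out_edges_inv e_in).
- move=> [rot gdE ->]; rewrite lE in rot *.
  move: sg; rewrite gdE sat0_cons /= andbT => ga.
  have an : a != tick by apply: contraTneq rot => ->; case: (w).
  have [gi1 gi2] := sat_invariantP _ _ gi; rewrite lE in gi1 gi2.
  (* Guard and invariant meet at p, so the reset amounts to subtracting p. *)
  have gaE : g a = p by apply/eqP; rewrite eq_le gi1.
  split; first by apply: contraTneq rot => ->; case: (w).
  left; exists w; split=> //; apply: (simulates_shift gs (lexx 0)).
  + by move=> b; rewrite hE; case: ifP.
  + apply/sat_invariantP; split=> [b rb|].
      by rewrite hE; case: ifP => _; [apply: le_trans p_ge1|apply: gi1].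
    by case: (w) gi2 => //; rewrite hE eq_sym (negPf an).
  + by move=> b nb; rewrite hE addr0; case: eqP nb => // ->; rewrite rot.
  + move=> b rb; rewrite hE addr0; case: eqP => [->|_]; [right|by left].
    by rewrite gaE subrr.
- by case=> -[b bE]; rewrite bE in lE.
- case=> pc' l'E [aE]; move: lE; rewrite l'E => -[pcE wE]; subst pc'; rewrite -wE in gs.
  have gg : good g rho := gs.1.
  have gh : good h rho by apply: (good_eq gg) => r b; rewrite hE aE.
  have wait := simulates_wait (pc := pc) (h := h) gg.
  have hr := instr_reg_le pc; have mE := mstepE pc rho; rewrite aE in hE.
  case E: (instr_at pc) mE hr wait => [r|r j] mE /= hr wait gspec; (split; first by rewrite aE).
    case: gspec => gdE ->; left; exists true; split=> //; apply: wait => //.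
    by move: sg; rewrite gdE sat0_cons /= andbT.
  case: gspec => -[gdE ->]; move: sg; rewrite gdE !sat0_cons /= andbT.
  + move=> /andP[xp yp]; right; exists j, rho; split=> //.
    by rewrite mE (good_zero hr gg xp) //; left.
  + move=> /andP[xp yp]; right; exists j, rho; split=> //.
    by rewrite mE (good_zero hr gg xp) //; right.
  + move=> /and3P[xp y0 yp]; left; exists true; split=> //.
    by apply: wait => //; apply: (good_pos hr gg xp); rewrite y0.
- case=> pc' l'E cases; move: lE; rewrite l'E => -[pcE wE]; subst pc'; rewrite -wE in gs.
  have [gg /(_ isT)[g1 _]] := gs; have hr := instr_reg_le pc.
  case: cases => [[gdE aE ->]|].
    move: sg; rewrite gdE sat0_cons /= andbT => g1'.
    split; first by rewrite aE; case: (instr_at pc).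
    right; rewrite aE in hE.
    have [||rho' mE gh] := simulates_exit gs _ _ hE.
    - by apply/eqP; rewrite eq_le g1.
    - by case E: (instr_at pc) hr => // /bnd.
    - by exists pc.+1, rho'.
  (* With the second marker at p and [tick] in (0, 1], the value of r is p minus [tick], at least p
     - 1, against the bound. The guard [tick] > 0 excludes coinciding markers, that is, value 0. *)
  case E: (instr_at pc) hr => [r|//] hr [gdE _ _]; exfalso.
  move: sg; rewrite gdE !sat0_cons /= andbT => /andP[xp y0].
  have [_ v2 ltp gapv] := gg r hr; have := bnd r hr.
  move: v2 gapv; rewrite /gap /= E /= eqxx mk_eq // andbF => v2 gapv.
  have r0 : 0 <= (rho r)%:R :> R by rewrite ler0n.
  by case: gapv => ?; lra.
Qed.

(** At time k all clocks show k except the first marker of register 0, just reset: its gap is k, all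
    others are 0. *)
Lemma start_good (f : act -> R) : k%:R < p ->
  (forall a, f a = if a == mk 0 false then 0 else k%:R) ->
  good f (minit k).2.
Proof.
move=> kp fE r hr; have k0 : 0 <= k%:R :> R by rewrite ler0n.
rewrite /gap !fE !mk_eq // andbT andbF /minit /= /set_reg.
by case: eqVneq => _; split; try lra; constructor 1; lra.
Qed.

Lemma UL_bounded :
  (forall n r, ((iter n (mstep D) (minit k)).2 r)%:R + 1 < p) -> UL R v A = bad_free.
Proof.
move=> bnd.
have kp : k%:R + 1 < p by have := bnd 0%N 0%N.
pose tracked l (mu : cvaluation R _) := match l : loc with
  | inl None => mu = zero_val R _
  | inl _ => True
  | inr (pc, w) => exists n rho,
      iter n (mstep D) (minit k) = (val pc, rho) /\ simulates pc w (clk mu) rho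
  end.
apply: (UL_bad_free (safe := fun s => exists l mu, s = at_loc l mu /\ tracked l mu)).
  by exists start, (zero_val R _).
have track_enter n pc rho mu : iter n (mstep D) (minit k) = (pc, rho) ->
    good (clk mu) rho -> tracked (enter pc) mu.
  by rewrite /enter; case: insubP => [i _ iE|//] nE gf; exists n, rho; rewrite iE.
move=> s d e s' [l [mu [-> tr]]] st.
have [g [a [l' [e_in eE -> [d0 mu0 mud] [gi sg gi']]]]] := step_elim st.
suff [? ?] : a != bad /\ tracked l' (reset (shift mu d) (enum_rank a)).
  split; first by exists l', (reset (shift mu d) (enum_rank a)).
  by rewrite eE => /enum_rank_inj /eqP; apply/negP.
case: l tr e_in gi {st} => [b|[pc w]] tr.
  rewrite mem_cat => /orP[|e_in _]; last first.
    case: (out_edges_inv e_in) => [[]|[_ _ an l'E]|[pc]|[pc]] //.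
    by split; [apply/eqP | case: l'E => ->].
  case: b tr => // muE /start_edges_inv[] [gE -> ->] _; move: sg;
    rewrite gE !sat0_cons /= !clk_shift muE /clk ffunE add0r andbT -/p -pmulrn.
    move=> /and3P[kd dk dp]; split=> //; apply: (track_enter 0%N) => //.
    apply: start_good => [|b]; first lra.
    rewrite clk_reset clk_shift /clk ffunE add0r.
    by case: ifP => // _; apply/eqP; rewrite eq_le dk.
  (* The initial edge that emits [bad] would need p <= k. *)
  by case/and4P; lra.
move=> e_in gi; case: tr => n [rho [nE sim]].
have [] := simulates_step sim d0 e_in erefl mud gi sg (clk_shift _ _) (clk_reset _ _).
  by move=> r _; have := bnd n r; rewrite nE.
move=> ab [[w' [-> sim']]|[pc' [rho' [-> mE gh]]]]; split=> //.
  by exists n, rho.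
by apply: (track_enter n.+1 _ rho') => //; rewrite iterS nE mE.
Qed.

(** * Reachability and the passage of time *)

Definition reach (s s' : config R 'I_#|act| 'I_#|loc|) : Prop :=
  exists r, finite_path v A s r s'.

Lemma reach_refl s : reach s s.
Proof. by exists [::]. Qed.

Lemma reach_trans s1 s2 s3 : reach s1 s2 -> reach s2 s3 -> reach s1 s3.
Proof.
move=> [r1 p1] [r2 p2]; exists (r1 ++ r2).
elim: r1 s1 p1 => [|[[d e] s] r1 IH] s1 /= => [->|[st p1]] //.
by split=> //; apply: IH.
Qed.

Lemma reach_step s1 s2 d e : step v A s1 d e s2 -> reach s1 s2.
Proof. by exists [:: (d, e, s2)]. Qed.

Lemma out_edge l t : t \in out_edges l -> t \in all_edges k l.
Proof. by move=> tl; rewrite /all_edges mem_cat tl orbT. Qed.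

(* Every clock is rotated at most once because d <= p; the induction is on the
   number of clocks that still have to be rotated, in the order of decreasing value. *)
Lemma advance l n mu d : nonneg mu -> 0 <= d <= p ->
  (forall a, rotating l a -> clk mu a <= p) ->
  (if l is inr (_, true) then clk mu tick + d <= 1 else True) ->
  (#|[pred a | rotating l a && (p < clk mu a + d)%R]| <= n)%N ->
  exists nu e, [/\ reach (at_loc l mu) (at_loc l nu), nonneg nu, 0 <= e,
    sat0 (clk (shift nu e)) (loc_inv l) &
    (forall a, ~~ rotating l a -> clk nu a + e = clk mu a + d) /\
    (forall a, rotating l a ->
      clk nu a + e = clk mu a + d \/
      p < clk mu a + d /\ clk nu a + e = clk mu a + d - p)].
Proof.
elim: n mu d => [|n IH] mu d mu0 /andP[d0 dp] rot_le tick_le cardP.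
  exists mu, d; split=> //; [exact: reach_refl | | by split=> // a _; left].
  apply/sat_invariantP; split=> [a ra|]; last first.
    by case: l tick_le {rot_le cardP} => [//|[pc []]] //; rewrite clk_shift.
  move: cardP; rewrite leqn0 => /eqP/card0_eq/(_ a); rewrite inE ra clk_shift /=.
  by move/negbT; rewrite -leNgt.
have [[a0 Pa0]|noP] := pselect (exists a, a \in [pred a | rotating l a && (p < clk mu a + d)]);
  last first.
  apply: IH => //; first exact/andP.
  rewrite eq_card0 // => a; apply/negbTE/negP => Pa; apply: noP.
  by exists a.
(* The largest of the clocks due to pass p gets there first, so no rotating clock exceeds p during
   this delay. *)
case: (arg_maxP (clk mu) Pa0) => a /andP[ra pa] amax.
have ap : clk mu a <= p := rot_le a ra.
set mu1 := reset (shift mu (p - clk mu a)) (enum_rank a).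
have mu1E b : clk mu1 b = if b == a then 0 else clk mu b + (p - clk mu a).
  by rewrite /mu1 clk_reset clk_shift.
have le_p b : rotating l b -> clk mu b + (p - clk mu a) <= p.
  move=> rb; have [pb|pb] := ltP p (clk mu b + d); last by lra.
  by have := amax b; rewrite /= rb pb /= => /(_ isT); lra.
have mu1_le b : rotating l b -> clk mu1 b <= p.
  by move=> rb; rewrite mu1E; case: ifP => _; [apply: le_trans p_ge1 | apply: le_p].
have tick_a : (if l is inr (_, true) then tick != a else True).
  by case: (l) ra => [//|[pc []]] //=; case: (a).
have st : step v A (at_loc l mu) (p - clk mu a)
    (ren_edge l ([:: (a, CGe, par0)], a, l)) (at_loc l mu1).
  apply: step_intro => //.
  - apply: out_edge; rewrite mem_cat; apply/orP; left; apply/mapP; exists a => //.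
    by rewrite mem_filter ra mem_enum.
  - by rewrite subr_ge0.
  - apply/sat_invariantP; split=> [b rb|]; first by rewrite clk_shift le_p.
    by case: (l) tick_le => [//|[pc []]] //; rewrite clk_shift; lra.
  - by rewrite sat0_cons /= clk_shift -/p andbT; lra.
  - apply/sat_invariantP; split=> [b rb|]; first exact: mu1_le.
    case: (l) tick_le tick_a => [//|[pc []]] // tick_le /negPf ta.
    by rewrite -/mu1 mu1E ta; lra.
have mu10 : nonneg mu1.
  by apply/nonneg_reset/nonneg_shift; rewrite ?subr_ge0.
have [|||nu [e [rnu nu0 e0 satnu [nuN nuR]]]] := IH mu1 (d - (p - clk mu a)) mu10 _ mu1_le.
- by apply/andP; split; lra.
- case: (l) tick_le tick_a => [//|[pc []]] // tick_le /negPf ta.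
  by rewrite mu1E ta; lra.
(* Clock [a] leaves the set, being 0 with at most p left to wait; for the other clocks, value plus
   remaining delay is unchanged. *)
- rewrite -ltnS; apply: leq_trans cardP; apply: proper_card; apply/properP; split.
    apply/fintype.subsetP => b; rewrite !inE mu1E => /andP[-> /=].
    by case: eqP => [->|_]; lra.
  exists a; rewrite !inE ra //= mu1E eqxx; lra.
exists nu, e; split=> //; first exact: reach_trans (reach_step st) rnu.
split=> b rb.
  rewrite nuN // mu1E; case: eqP => [ba|_]; last by lra.
  by rewrite ba ra in rb.
have := nuR b rb; rewrite mu1E; case: eqP => [->|_] [nuE|[lt_p nuE]].
- by right; split=> //; lra.
- by lra.
- by left; lra.
- by right; split; lra.
Qed.

End Valuation.
End Automaton.

Arguments mk {D}.
Arguments moved {D}.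
Arguments tick {D}.
Arguments bad {D}.
Arguments start {D}.
Arguments free {D}.
Arguments dead {D}.
Arguments enter {D}.

(** * Completeness of the simulation *)

Section Completeness.
Variables (D : machine) (R : realType) (v : pvaluation 'I_1) (k : nat).

Let p : R := ratr (val (v ord0)).

Hypothesis p_gt1 : 1 < p.
Hypothesis p_gtk : k%:R < p.

Let p_ge1 : 1 <= p := ltW p_gt1.

Implicit Types (mu nu : cvaluation R 'I_#|act D|) (pc : 'I_(size D)).

(** The last delay [e] stays pending, since a step is a delay followed by an edge. A clock that ends
    at p or below is not rotated, so a marker can be stopped exactly at p. *)
Lemma advance_simulation pc w mu d rho : nonneg mu ->
  simulates v pc w (clk mu) rho -> 0 <= d <= p -> (w -> clk mu tick + d <= 1) ->
  exists nu e, [/\ reach v k (at_loc (inr (pc, w)) mu) (at_loc (inr (pc, w)) nu),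
    nonneg nu, 0 <= e, simulates v pc w (clk (shift nu e)) rho &
    forall a, (rotating (inr (pc, w)) a -> clk mu a + d <= p) ->
      clk (shift nu e) a = clk mu a + d].
Proof.
move=> mu0 sim d01 tick1.
have [||nu [e [rnu nu0 e0 snu [nuN nuR]]]] :=
  advance k p_ge1 (l := inr (pc, w)) mu0 d01 _ _ (leqnn _).
- by move=> a; apply: simulates_le sim.
- by case: (w) tick1 => // ->.
exists nu, e; split=> //.
  apply: (simulates_shift p_ge1 sim (d := d)) => //.
  - by case/andP: d01.
  - by move=> a; apply: nonneg_shift.
  - by move=> a /nuN <-; rewrite clk_shift.
  - by move=> a /nuR[<-|[_ <-]]; rewrite clk_shift; [left|right].
move=> a rot_le; rewrite clk_shift; have [ra|/nuN//] := boolP (rotating (inr (pc, w)) a).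
by have [//|[]] := nuR a ra; rewrite ltNge rot_le.
Qed.

Definition reach_bad (s : config R 'I_#|act D| 'I_#|loc D|) : Prop :=
  exists s1 d e mu, [/\ reach v k s s1, step v (simulator D k) s1 d e (at_loc dead mu)
    & edge_action e = enum_rank bad].

Lemma reach_bad_trans s1 s2 : reach v k s1 s2 -> reach_bad s2 -> reach_bad s1.
Proof.
move=> r12 [s [d [e [mu [r2 st eE]]]]]; exists s, d, e, mu.
by split=> //; apply: reach_trans r2.
Qed.

Lemma sat_dead (f : act D -> R) : sat0 v f (loc_inv dead).
Proof. exact/sat_invariantP. Qed.

Lemma sat_enter n (f : act D -> R) rho : good v f rho -> sat0 v f (loc_inv (enter n)).
Proof.
rewrite /enter; case: insubP => [i _ _|_ _]; last exact: sat_dead.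
by move=> gf; apply: (simulates_invariant (rho := rho)); split.
Qed.

Lemma simulate_mstep pc mu rho (pc' : nat) rho' : nonneg mu -> good v (clk mu) rho ->
  mstep D (val pc, rho) = (pc', rho') ->
  reach_bad (at_loc (run_at pc) mu) \/
  exists mu', [/\ reach v k (at_loc (run_at pc) mu) (at_loc (enter pc') mu'),
    nonneg mu' & good v (clk mu') rho'].
Proof.
move=> mu0 gmu mE; have hr := instr_reg_le pc.
have hb : exists r b, moved (instr_at pc) = mk r b :> act D /\ (r <= max_reg D)%N.
  by case: (instr_at pc) hr => [r|r j] hr; do 2 eexists.
have m_le : 0 <= clk mu (moved (instr_at pc)) <= p.
  have [r [b [-> hr']]] := hb; have [? ? _ _] := gmu r hr'; by case: (b).
have sim : simulates v pc false (clk mu) rho by split.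
(* This delay brings the marker to be moved exactly to p, as the guard of every instruction edge
   requires. *)
have d01 : 0 <= p - clk mu (moved (instr_at pc)) <= p by apply/andP; split; lra.
have [//|nu [e [rnu nu0 e0 snu nuE]]] := advance_simulation mu0 sim d01 _.
have gnu : good v (clk (shift nu e)) rho := snu.1.
have nup : clk (shift nu e) (moved (instr_at pc)) = p.
  by rewrite nuE; lra.
have nue0 := nonneg_shift nu0 e0.
have inv_nu := simulates_invariant snu.
have enter_step g a n : (g, a, enter n) \in out_edges (run_at pc) ->
    sat0 v (clk (shift nu e)) g -> a = tick ->
    exists mu', [/\ reach v k (at_loc (run_at pc) mu) (at_loc (enter n) mu'),
      nonneg mu' & good v (clk mu') rho].
  move=> e_in satg aE; exists (reset (shift nu e) (enum_rank a)).
  have good' : good v (clk (reset (shift nu e) (enum_rank a))) rho.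
    by apply: (good_eq gnu) => r b; rewrite clk_reset aE.
  split=> //; last exact: nonneg_reset.
  apply: reach_trans rnu (reach_step (d := e) (e := ren_edge (run_at pc) (g, a, enter n)) _).
  apply: step_intro => //.
  exact: sat_enter good'.
have wait_step g : (g, tick, wait_at pc) \in out_edges (run_at pc) ->
    sat0 v (clk (shift nu e)) g ->
    (if instr_at pc is Dec r _ then (0 < rho r)%N else True) ->
    exists mu', [/\ reach v k (at_loc (run_at pc) mu) (at_loc (wait_at pc) mu'),
      nonneg mu', clk mu' tick = 0 & simulates v pc true (clk mu') rho].
  move=> e_in satg rpos; exists (reset (shift nu e) (enum_rank tick)).
  have sim' : simulates v pc true (clk (reset (shift nu e) (enum_rank tick))) rho.
    by apply: (simulates_wait p_ge1 gnu) => // [|b]; rewrite ?nup ?clk_reset.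
  split=> //; [|exact: nonneg_reset|by rewrite clk_reset eqxx].
  apply: reach_trans rnu (reach_step (d := e) (e := ren_edge (run_at pc) (g, tick, wait_at pc)) _).
  apply: step_intro => //.
  exact: simulates_invariant sim'.
have exit_step mu1 : reach v k (at_loc (run_at pc) mu) (at_loc (wait_at pc) mu1) ->
    nonneg mu1 -> clk mu1 tick = 0 -> simulates v pc true (clk mu1) rho ->
    (if instr_at pc is Inc r then (rho r)%:R + 1 < p else true) ->
    exists mu', [/\ reach v k (at_loc (run_at pc) mu) (at_loc (enter pc') mu'),
      nonneg mu' & good v (clk mu') rho'].
  move=> r1 mu10 tick0 sim1 rlt.
  have d01' : (0 : R) <= 1 <= p by rewrite ler01 p_ge1.
  have [|nu1 [e1 [rnu1 nu10 e10 snu1 nu1E]]] := advance_simulation mu10 sim1 d01' _.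
    by rewrite tick0 add0r.
  have nut : clk (shift nu1 e1) tick = 1 by rewrite nu1E ?tick0 ?add0r.
  have [rho1] := simulates_exit (h := clk (reset (shift nu1 e1) (enum_rank (moved (instr_at pc)))))
    snu1 nut rlt (clk_reset _ _).
  rewrite mE => -[pcE ->] good'; eexists; split; last exact: good'.
    apply: reach_trans r1 (reach_trans rnu1 (reach_step (d := e1)
      (e := ren_edge (wait_at pc) ([:: (tick, CGe, inr 1)], moved (instr_at pc), enter pc.+1)) _)).
    rewrite pcE; apply: step_intro => //.
    - apply: out_edge; rewrite mem_cat; apply/orP; right; exact: mem_head.
    - exact: simulates_invariant snu1.
    - by rewrite sat0_cons /= nut lexx.
    - exact: sat_enter good'.
  exact/nonneg_reset/nonneg_shift.
case E: (instr_at pc) mE hr nup => [r|r j] mE /= hr nup.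
  have run_out t : t = ([:: (mk r false, CGe, par0)], tick, wait_at pc) ->
      t \in out_edges (run_at pc).
    by move=> ->; rewrite mem_cat; apply/orP; right; rewrite E mem_head.
  have [||mu1 [r1 mu10 tick0 sim1]] := wait_step _ (run_out _ erefl).
  - by rewrite sat0_cons /= nup lexx.
  - by rewrite E.
  (* Either the increment fits below p, or it overflows and [bad] becomes available. *)
  have [lt_p|le_p] := ltP ((rho r)%:R + 1) p.
    by right; apply: (exit_step mu1) => //; rewrite ?E.
  left; apply: (reach_bad_trans r1).
  have := sim1.1 r hr; rewrite /gap /= E /= eqxx mk_eq // andbF tick0 subr0.
  move=> [_ x1 ltp gapx].
  have rho1 : (0 < rho r)%N.
    by rewrite lt0n; apply/eqP => r0; move: le_p; rewrite r0 add0r leNgt p_gt1.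
  have x1E : clk mu1 (mk r true) = (rho r)%:R.
    by rewrite -(ltr0n R) in rho1; case: gapx => ?; lra.
  (* The second marker shows [rho r], so after this delay, which is positive and at most 1, it is at
     p while [tick] is still at most 1. *)
  have d01' : 0 <= p - (rho r)%:R <= p.
    by rewrite subr_ge0 ltW // gerBl ler0n.
  have [_|nu1 [e1 [rnu1 nu10 e10 snu1 nu1E]]] := advance_simulation mu10 sim1 d01' _.
    by rewrite tick0; lra.
  have bE : ([:: (mk r true, CGe, par0); (tick, CGt, inr 0)], bad, dead)
      \in out_edges (wait_at pc).
    rewrite mem_cat; apply/orP; right; rewrite E; by rewrite !inE eqxx orbT.
  exists (at_loc (wait_at pc) nu1), e1, (ren_edge (wait_at pc)
    ([:: (mk r true, CGe, par0); (tick, CGt, inr 0)], bad, dead)); eexists.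
  split=> //; apply: step_intro => //; last exact: sat_dead.
  - exact: simulates_invariant snu1.
  - rewrite !sat0_cons /= !nu1E ?tick0 // ?x1E; first by apply/and3P; split=> //; lra.
    by move=> _; lra.
rewrite mstepE E in mE.
have e_in t : t \in [:: ([:: (mk r true, CGe, par0); (mk r false, CGe, par0)], tick, enter j);
    ([:: (mk r true, CGe, par0); (mk r false, CLe, inr 0)], tick, enter j);
    ([:: (mk r true, CGe, par0); (mk r false, CGt, inr 0); (mk r false, CLt, par0)],
     tick, wait_at pc)] -> t \in out_edges (run_at pc).
  by move=> tl; rewrite mem_cat; apply/orP; right; rewrite E.
have p_le : p <= clk (shift nu e) (mk r true) by rewrite nup.
have zero_step g : (g, tick, enter j) \in out_edges (run_at pc) ->
    sat0 v (clk (shift nu e)) g ->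
    p <= clk (shift nu e) (mk r false) \/ clk (shift nu e) (mk r false) <= 0 ->
    exists mu', [/\ reach v k (at_loc (run_at pc) mu) (at_loc (enter pc') mu'),
      nonneg mu' & good v (clk mu') rho'].
  move=> ge_in satg xr; move: mE; rewrite (good_zero hr gnu p_le xr) => -[<- <-].
  exact: enter_step ge_in satg erefl.
(* The second marker is at p. The register is zero if the first is at p or just reset, and positive
   if it lies strictly between. *)
right; have [xp|xp] := leP p (clk (shift nu e) (mk r false)).
  apply: zero_step (e_in _ (mem_head _ _)) _ (or_introl xp).
  by rewrite !sat0_cons /= p_le xp.
have [x0|x0] := leP (clk (shift nu e) (mk r false)) 0.
  apply: zero_step (e_in ([:: (mk r true, CGe, par0); (mk r false, CLe, inr 0)],
    tick, enter j) _) _ (or_intror x0); first by rewrite !inE eqxx orbT.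
  by rewrite !sat0_cons /= p_le x0.
have rpos : (0 < rho r)%N by apply: (good_pos hr gnu p_le); rewrite x0.
have [|||mu1 [r1 mu10 tick0 sim1]] := wait_step _ (e_in ([:: (mk r true, CGe, par0);
    (mk r false, CGt, inr 0); (mk r false, CLt, par0)], tick, wait_at pc) _) _ _.
- by do 2 (rewrite in_cons; apply/orP; right); exact: mem_head.
- by rewrite !sat0_cons /= p_le x0 xp.
- by rewrite E.
by apply: (exit_step mu1) => //; rewrite ?E.
Qed.
Lemma simulate_run n :
  reach_bad (init_config R (simulator D k)) \/
  exists mu, [/\ reach v k (init_config R (simulator D k))
      (at_loc (enter (iter n (mstep D) (minit k)).1) mu),
    nonneg mu & good v (clk mu) (iter n (mstep D) (minit k)).2].
Proof.
elim: n => [|n [IH|[mu [r_mu mu0 gmu]]]]; last 2 first.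
- by left.
- move: r_mu gmu; rewrite iterS; case: (iter n _ _) => pc rho /= r_mu gmu.
  have [lt_pc|le_pc] := ltnP pc (size D); last first.
    by right; exists mu; rewrite /mstep onth_default.
  have {}r_mu : reach v k (init_config R (simulator D k)) (at_loc (run_at (Ordinal lt_pc)) mu).
    by move: r_mu; rewrite /enter insubT.
  case mE: (mstep D (pc, rho)) => [pc' rho'].
  have [bad_mu|[mu' [r_mu' mu'0 gmu']]] :=
      simulate_mstep (pc := Ordinal lt_pc) mu0 gmu mE.
    by left; apply: reach_bad_trans r_mu bad_mu.
  by right; exists mu'; split=> //; apply: reach_trans r_mu r_mu'.
right; set mu := zero_val R 'I_#|act D|.
have k0 : 0 <= k%:R :> R by rewrite ler0n.
have mu0 : nonneg mu by move=> a; rewrite /clk ffunE.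
have muk a : clk (shift mu k%:R) a = k%:R by rewrite clk_shift /clk ffunE add0r.
have gk : good v (clk (reset (shift mu k%:R) (enum_rank (mk 0 false)))) (minit k).2.
  by apply: start_good => // a; rewrite clk_reset muk.
exists (reset (shift mu k%:R) (enum_rank (mk 0 false))); split=> //; last first.
  exact/nonneg_reset/nonneg_shift.
apply: (reach_step (d := k%:R) (e := ren_edge start
  ([:: (tick, CGe, inr (Posz k)); (tick, CLe, inr (Posz k)); (tick, CLt, par0)],
   mk 0 false, enter 0))).
apply: step_intro => //.
- by rewrite mem_cat mem_head.
- exact/sat_invariantP.
- by rewrite !sat0_cons /= !muk -pmulrn lexx andbT; exact: p_gtk.
- exact: sat_enter gk.
Qed.

End Completeness.

(** * Unbounded registers change the language *)

Lemma reach_bad_word (D : machine) (R : realType) (v : pvaluation 'I_1) (k : nat) :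
  reach_bad v k (init_config R (simulator D k)) ->
  UL R v (simulator D k) <> @bad_free D.
Proof.
move=> [s1 [d [e [mu [[r r_s1] st eE]]]]] ULE.
have : bad_free (FinWord (rcons [seq edge_action t.1.2 | t <- r] (enum_rank (@bad D)))).
  rewrite -ULE; split; first exact: init_state.
  exists (rcons r (d, e, at_loc dead mu)), (at_loc dead mu); split.
  - elim: r (init_config _ _) r_s1 {ULE} => [s -> //|[[d0 e0] s0] r IH] s /= [? ?].
    by split=> //; apply: IH.
  - exact: dead_stuck.
  - by rewrite map_rcons /= eE.
by case=> _; rewrite mem_rcons mem_head.
Qed.

(** If p <= k, then [bad] can be emitted at time p from [start]. If p > k, a simulation that never
    reaches [bad] would keep register 0 below p for ever. *)
Lemma UL_unbounded (D : machine) (R : realType) (v : pvaluation 'I_1) (k : nat) :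
  (0 < k)%N -> 0 < val (v ord0) ->
  (forall B, exists n, (B <= (iter n (mstep D) (minit k)).2 0)%N) ->
  UL R v (simulator D k) <> @bad_free D.
Proof.
move=> k0 v0 unb; apply: reach_bad_word; set p : R := ratr (val (v ord0)).
have p0 : 0 < p by rewrite ltr0q.
have [p_lek|p_gtk] := leP p k%:R; last first.
  have p_gt1 : 1 < p by apply: le_lt_trans p_gtk; rewrite ler1n.
  have [n Bn] := unb (Num.bound p).
  have [//|[mu [_ _ gmu]]] := simulate_run D p_gt1 p_gtk n.
  have [_ _ + _] := gmu 0%N isT; rewrite ltNge.
  have := archi_boundP (ltW p0) => pB /negP[]; apply: ltW; apply: lt_le_trans pB _.
  by rewrite ler_nat.
set mu := zero_val R 'I_#|act D|.
have mu0 : nonneg mu by move=> a; rewrite /clk ffunE.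
have mup a : clk (shift mu p) a = p by rewrite clk_shift /clk ffunE add0r.
exists (init_config R (simulator D k)), p, (ren_edge start
  ([:: (tick, CGt, inr 0); (tick, CGe, par0); (tick, CLe, par0);
       (tick, CLe, inr (Posz k))], bad, dead)),
  (reset (shift mu p) (enum_rank bad)).
split=> //; first exact: reach_refl.
apply: (step_intro (l := start)) => //; last exact: sat_dead.
- by rewrite mem_cat !inE eqxx orbT.
- exact: ltW.
- exact/sat_invariantP.
- by rewrite !sat0_cons /= !mup lexx p0 -pmulrn p_lek.
Qed.

(** * The reduction *)

Definition ref_val : pvaluation 'I_1 := [ffun=> exist _ (0 : rat) (lexx 0)].

Definition pera_instance (D : machine) (k : nat) : instance :=
  Instance (simulator D k) ref_val.

Lemma pera_preserved (R : realType) D k n :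
  (size D <= (iter n (mstep D) (minit k)).1)%N ->
  language_preservation R (pera_instance D k).
Proof.
(* The registers never exceed k + n, so p = k + n + 2 lies strictly above every register plus 1. *)
move=> halt; set q : rat := (k + n).+2%:R.
have q0 : 0 <= q by rewrite ler0n.
pose v1 : pvaluation 'I_1 := [ffun=> exist _ q q0].
exists v1; split.
  move=> /ffunP/(_ ord0)/(congr1 val); rewrite !ffunE /= => /eqP.
  by rewrite pnatr_eq0.
have ref0 : ratr (val (ref_val ord0)) = 0 :> R by rewrite ffunE rmorph0.
rewrite (UL_zero D k ref0) //.
have pE : ratr (val (v1 ord0)) = (k + n).+2%:R :> R.
  by rewrite ffunE /= ratr_nat.
apply: UL_bounded; rewrite pE ?ler1n // => m r.
by rewrite natr1 ltr_nat !ltnS; apply: halted_le halt.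
Qed.

Lemma pera_not_preserved (R : realType) D k : (0 < k)%N ->
  (forall B, exists n, (B <= (iter n (mstep D) (minit k)).2 0)%N) ->
  ~ language_preservation R (pera_instance D k).
Proof.
move=> k0 unb [v' [v'ne]] /=.
have ref0 : ratr (val (ref_val ord0)) = 0 :> R by rewrite ffunE rmorph0.
rewrite (UL_zero D k ref0); apply: UL_unbounded => //.
(* There is one parameter and its reference value is 0, so any other valuation makes it positive. *)
rewrite lt_neqAle (valP (v' ord0)) andbT eq_sym; apply: contra_notN v'ne => /eqP v0.
by apply/ffunP => i; rewrite ord1 ffunE; apply: val_inj.
Qed.

(** [None] marks the three occurrences of k, all in the guards of [start_edges]. That [T] is
    nonempty makes its numeral positive. *)
Lemma ser_template D : exists T : seq (option nat), T != [::] /\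
  forall k, ser_instance (pera_instance D k) = map (odflt k) T.
Proof.
pose I0 := pera_instance D 0; pose C := map (@Some nat); pose V : option nat := None.
pose other := flatten [seq map (ren_edge l) (out_edges l) | l <- enum (loc D)].
pose t := nat_of_ord (enum_rank (@tick D)); pose s0 := nat_of_ord (enum_rank (@start D)).
exists (C ([:: nact I0; nloc I0; npar I0; nat_of_ord (init (aut I0))] ++
    ser_seq (fun q : Qplus => ser_rat (val q)) (codom (par I0)) ++
    ser_seq (ser_seq (@ser_atom _ _)) (codom (Defs.inv (aut I0))) ++
    [:: (size other).+2; s0; nat_of_ord (enum_rank (@mk D 0 false));
        nat_of_ord (enum_rank (@enter D 0)); 3; t; 2; 1; 0]) ++ V ::
  C [:: t; 1; 1; 0] ++ V ::
  C ([:: t; 0; 0; 0] ++ [:: s0; nat_of_ord (enum_rank (@bad D));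
        nat_of_ord (enum_rank (@dead D)); 4; t; 3; 1; 0; 0; t; 2; 0; 0;
        t; 1; 0; 0; t; 1; 1; 0]) ++ V ::
  C (flatten (map (@ser_edge _ _ _) other))); split=> // k.
have CE x : map (odflt k) (C x) = x by rewrite -map_comp map_id.
by rewrite /V !(map_cat, map_cons, CE) /ser_instance /ser_seq /= -!catA /= -!catA.
Qed.

Theorem theorem1 (R : realType) :
  ~ decidable_problem encode (language_preservation R).
Proof.
move=> [M decM]; set D := diagonal M; have [T [Tn TE]] := ser_template D.
(* The template depends on [D] alone, so its own numeral may be taken as the input k. *)
set ds := digits T; set k := numeral ds.
have [dec1 dec0] := decM (pera_instance D k).
have codeE : encode (pera_instance D k) = foldl (apply_digit k) 0%N ds.
  by rewrite /encode TE digitsP.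
have k0 : (0 < k)%N.
  by rewrite /k /ds; case: (T) Tn => // o T' _ /=; case: (digits T').
rewrite codeE in dec1 dec0.
(* If the language were preserved, [M] would answer 1 and register 0 would grow without bound, so it
   would not be preserved. *)
have nLP : ~ language_preservation R (pera_instance D k).
  move=> LP; apply: (pera_not_preserved k0 _ LP) => B.
  exact: diagonal_grows (dec1 LP) B erefl.
(* Hence [M] answers 0 and [D] halts, which bounds the registers and preserves the language after
   all. *)
have [n halt] := diagonal_halts (dec0 nLP) erefl.
exact/nLP/(pera_preserved _ halt).
Qed.
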